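(* Let $\sigma_1,\dots,\sigma_m$ be single-qubit states. Then $$\Lambda\Big(\bigotimes_j\sigma_j\Big)=\Xi\Big(\bigotimes_j\sigma_j\Big)=\Lambda^+\Big(\bigotimes_j\sigma_j\Big)=\prod_j\Lambda^+(\sigma_j),$$ and furthermore $\bigotimes_j\sigma_j$ admits an equimagical decomposition.
   Context: $\mathrm{S}_n$ denotes the set of pure $n$-qubit stabilizer states (states $|\psi\rangle$ for which there is an abelian subgroup of the $n$-qubit Pauli group with $2^n$ elements all of which fix $|\psi\rangle$), and $\bar{\mathrm S}_n=\mathrm{conv}\{|\phi\rangle\langle\phi|:|\phi\rangle\in\mathrm S_n\}$ the mixed stabilizer states; all monotones below are taken with respect to the number of qubits of their argument. The stabilizer extent of a pure state is $\xi(\Psi)=\min\{\|c\|_1^2: |\Psi\rangle=\sum_j c_j|\phi_j\rangle,\ |\phi_j\rangle\in\mathrm S_n\}$. The mixed-state extent is $\Xi(\rho)=\min\{\sum_j p_j\xi(\Psi_j):\rho=\sum_jp_j|\Psi_j\rangle\langle\Psi_j|\}$ over convex decompositions into pure states; if the minimum is attained by a decomposition with all $\xi(\Psi_j)$ equal, $\rho$ admits an equimagical decomposition. The dyadic negativity is $\Lambda(\rho)=\min\{\|\alpha\|_1:\rho=\sum_j\alpha_j|L_j\rangle\langle R_j|,\ |L_j\rangle,|R_j\rangle\in\mathrm S_n,\ \alpha_j\in\mathbb C\}$. The generalized robustness is $\Lambda^+(\rho)=\min\{\lambda:\rho\le\lambda\sigma,\ \sigma\in\bar{\mathrm S}_n\}$.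 *)

(* Defs.v *)
From HB Require Import structures.
From mathcomp Require Import all_boot all_order all_algebra.
From mathcomp Require Import all_classical all_reals.
From mathcomp Require Import complex.
Set Implicit Arguments. Unset Strict Implicit. Unset Printing Implicit Defensive.
Import Order.TTheory GRing.Theory Num.Theory.
Local Open Scope ring_scope.

Section QDefs.
Variable R : realType.
Local Notation C := R[i].
Local Notation toC := (real_complex R).

Definition cabs (z : C) : R := Normc.normc z.

Definition qbasis (n : nat) := {ffun 'I_n -> bool}.
(* vectors of (C^2)^{\otimes n} and operators on it (entries in the comp. basis) *)
Definition vec (n : nat) := qbasis n -> C.
Definition op (n : nat) := qbasis n -> qbasis n -> C.

Definition opmul n (A B : op n) : op n := fun x y => \sum_z A x z * B z y.
Definition opapp n (A : op n) (v : vec n) : vec n := fun x => \sum_y A x y * v y.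

(* single-qubit Pauli matrices: 0 = I, 1 = X, 2 = Y, 3 = Z; basis false=|0>, true=|1> *)
Definition pauli1 (p : 'I_4) (a b : bool) : C :=
  match val p with
  | 0 => if a == b then 1 else 0
  | 1 => if a == b then 0 else 1
  | 2 => if a == b then 0 else (if a then 'i else - 'i)
  | _ => if a == b then (if a then -1 else 1) else 0
  end.

(* elements of the n-qubit Pauli group: i^k P_1 (x) ... (x) P_n, labelled by (k, s) *)
Definition plabel (n : nat) := ('I_4 * {ffun 'I_n -> 'I_4})%type.
Definition pauli_op n (a : plabel n) : op n :=
  fun x y => 'i ^+ a.1 * \prod_(q < n) pauli1 (a.2 q) (x q) (y q).
Definition plabel_id n : plabel n := (ord0, [ffun => ord0]).

Definition abelian_pauli_subgroup n (S : {set plabel n}) : Prop :=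
  [/\ plabel_id n \in S,
      (forall a b, a \in S -> b \in S -> exists2 c, c \in S &
          forall x y, pauli_op c x y = opmul (pauli_op a) (pauli_op b) x y),
      (forall a, a \in S -> exists2 b, b \in S &
          forall x y, opmul (pauli_op a) (pauli_op b) x y = pauli_op (plabel_id n) x y),
      (forall a b, a \in S -> b \in S -> forall x y,
          opmul (pauli_op a) (pauli_op b) x y = opmul (pauli_op b) (pauli_op a) x y)
    & #|S| = (2 ^ n)%N].

Definition unit_vec n (v : vec n) : Prop := \sum_x `|v x| ^+ 2 = 1.

Definition stab_state n (phi : vec n) : Prop :=
  unit_vec phi /\ exists S : {set plabel n}, abelian_pauli_subgroup S /\
    forall a, a \in S -> forall x, opapp (pauli_op a) phi x = phi x.

Definition psd n (A : op n) : Prop :=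
  forall v : vec n, 0 <= \sum_x \sum_y Num.conj (v x) * A x y * v y.

Definition dstate n (rho : op n) : Prop := psd rho /\ \sum_x rho x x = 1.

Definition dyad n (L Rv : vec n) : op n := fun x y => L x * Num.conj (Rv y).

Definition mixed_stab n (sigma : op n) : Prop :=
  exists (k : nat) (p : 'I_k -> R) (phi : 'I_k -> vec n),
    [/\ forall j, 0 <= p j, \sum_j p j = 1, forall j, stab_state (phi j)
      & forall x y, sigma x y = \sum_j toC (p j) * dyad (phi j) (phi j) x y].

Definition extent n (psi : vec n) : R :=
  inf [set r : R | exists (k : nat) (c : 'I_k -> C) (phi : 'I_k -> vec n),
    [/\ forall j, stab_state (phi j),
        forall x, psi x = \sum_j c j * phi j x
      & r = (\sum_j cabs (c j)) ^+ 2]].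

Definition pure_decomp n (rho : op n) k (p : 'I_k -> R) (psi : 'I_k -> vec n) : Prop :=
  [/\ forall j, 0 <= p j, \sum_j p j = 1, forall j, unit_vec (psi j)
    & forall x y, rho x y = \sum_j toC (p j) * dyad (psi j) (psi j) x y].

Definition mixed_extent n (rho : op n) : R :=
  inf [set r : R | exists (k : nat) (p : 'I_k -> R) (psi : 'I_k -> vec n),
    pure_decomp rho p psi /\ r = \sum_j p j * extent (psi j)].

Definition dyadic_neg n (rho : op n) : R :=
  inf [set r : R | exists (k : nat) (al : 'I_k -> C) (L Rv : 'I_k -> vec n),
    [/\ forall j, stab_state (L j), forall j, stab_state (Rv j),
        forall x y, rho x y = \sum_j al j * dyad (L j) (Rv j) x y
      & r = \sum_j cabs (al j)]].

Definition gen_rob n (rho : op n) : R :=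
  inf [set l : R | exists sigma : op n,
    mixed_stab sigma /\ psd (fun x y => toC l * sigma x y - rho x y)].

Definition equimagical n (rho : op n) : Prop :=
  exists (k : nat) (p : 'I_k -> R) (psi : 'I_k -> vec n),
    [/\ pure_decomp rho p psi,
        \sum_j p j * extent (psi j) = mixed_extent rho
      & forall i j, extent (psi i) = extent (psi j)].

Definition tensor m (sigma : 'I_m -> op 1) : op m :=
  fun x y => \prod_(j < m) sigma j [ffun _ => x j] [ffun _ => y j].

End QDefs.

(* Main.v *)
Require Import Defs.
From HB Require Import structures.
From mathcomp Require Import all_boot all_order all_algebra.
From mathcomp Require Import all_classical all_reals.
From mathcomp Require Import complex ring lra.
Set Implicit Arguments. Unset Strict Implicit. Unset Printing Implicit Defensive.
Import Order.TTheory GRing.Theory Num.Theory.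
Local Open Scope ring_scope.

(** All four quantities are squeezed between an explicit decomposition and an
    explicit dual witness, both of product form.

    One qubit: outside the stabilizer octahedron, the Bloch vector of a state
    can be written (1 + m) w + m u with |w|_1 = 1 and u a unit vector such
    that the stabilizer states in the support of w all have the maximal
    fidelity F with the pure state omega of Bloch vector u. Superpositions
    of these stabilizer states, with phases aligned along omega, have extent
    at most v = 1 + m, and the state is a mixture of such superpositions of
    norm 1: a segment or triangle whose vertices lie outside the Bloch ball
    meets the ball in the convex hull of its points on the sphere. The witness
    omega omega^* / F is at most 1 on stabilizer states and equals v on each
    component of the mixture.

    Many qubits: products of these witnesses are still at most 1 on stabilizer
    states. This is proved one qubit at a time: projecting a qubit of a
    stabilizer state onto a Pauli eigenstate gives a stabilizer state whose
    squared norm halves unless the state is a product, and two positive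
    one-qubit operators with stabilizer expectations at most 1 have
    Hilbert-Schmidt product at most 2. *)

(** * Pairing of Bloch vectors *)

Section RealInequality.
Variable R : realFieldType.
Implicit Types (a s k M : R).

(** Lagrange's identity: the product of the squared norms exceeds the squared pairing by three
    squares of minors. *)
Lemma bloch_cs a0 a1 a2 a3 k s1 s2 s3 :
  0 <= a0 -> 0 <= k -> a1 ^+ 2 + a2 ^+ 2 + a3 ^+ 2 <= a0 ^+ 2 ->
  s1 ^+ 2 + s2 ^+ 2 + s3 ^+ 2 <= k ^+ 2 ->
  a1 * s1 + a2 * s2 + a3 * s3 <= a0 * k.
Proof.
move=> a0p kp ha hs; set d := _ + a3 * s3.
have [d0|d0] := lerP d 0; first by rewrite (le_trans d0) // mulr_ge0.
rewrite -(@ler_pXn2r _ 2) ?nnegrE ?mulr_ge0 //; last exact: ltW.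
have : d ^+ 2 <= (a1 ^+ 2 + a2 ^+ 2 + a3 ^+ 2) * (s1 ^+ 2 + s2 ^+ 2 + s3 ^+ 2).
  have h1 := sqr_ge0 (a1 * s2 - a2 * s1).
  have h2 := sqr_ge0 (a1 * s3 - a3 * s1).
  have h3 := sqr_ge0 (a2 * s3 - a3 * s2).
  rewrite /d; nra.
move=> h; rewrite (le_trans h) // exprMn ler_pM //.
- by rewrite !addr_ge0 ?sqr_ge0.
- by rewrite !addr_ge0 ?sqr_ge0.
Qed.

(** For [a0] near 1 the other [a] coordinates are small, so the pairing is at most (1 - a0) S with S
    = |s|_1. Two bounds on S compete: sqrt 3 k, from the Euclidean norm, and 3 (1 - k). *)
Lemma bloch_far a0 a1 a2 a3 k s1 s2 s3 :
  0 <= k -> a0 <= 1 -> 7 / 10 <= a0 -> s1 ^+ 2 + s2 ^+ 2 + s3 ^+ 2 <= k ^+ 2 ->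
  `|a1| <= 1 - a0 -> `|a2| <= 1 - a0 -> `|a3| <= 1 - a0 ->
  `|s1| <= 1 - k -> `|s2| <= 1 - k -> `|s3| <= 1 - k ->
  a0 * k + (a1 * s1 + a2 * s2 + a3 * s3) <= 1.
Proof.
move=> kp a0l a0g hs A1 A2 A3 S1 S2 S3.
pose S : R := `|s1| + `|s2| + `|s3|.
(* The constant 7/4 is a rational upper bound for sqrt 3. *)
have SK : S <= 7 / 4 * k.
  rewrite -(@ler_pXn2r _ 2) ?nnegrE ?addr_ge0 //; last by lra.
  have h1 := sqr_ge0 (`|s1| - `|s2|).
  have h2 := sqr_ge0 (`|s1| - `|s3|).
  have h3 := sqr_ge0 (`|s2| - `|s3|).
  rewrite -[s1 ^+ 2]real_normK ?num_real // -[s2 ^+ 2]real_normK ?num_real // in hs.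
  rewrite -[s3 ^+ 2]real_normK ?num_real // in hs.
  rewrite /S; have := sqr_ge0 k; nra.
have S3' : S <= 3 * (1 - k) by rewrite /S; lra.
have P (a s : R) : `|a| <= 1 - a0 -> a * s <= (1 - a0) * `|s|.
  by move=> h; rewrite (le_trans (ler_norm _)) // normrM ler_wpM2r.
have : a1 * s1 + a2 * s2 + a3 * s3 <= (1 - a0) * S.
  by rewrite /S !mulrDr !lerD // P.
move=> hS; suff: a0 * k + (1 - a0) * S <= 1 by lra.
(* Up to k = 4/7 the bound 7/4 k on S is at most 1, and a0 k + (1 - a0) S is a convex combination of
   numbers at most 1. *)
have [kl|kg] := lerP k (4 / 7).
  have S1' : S <= 1 by lra.
  nra.
have h : (1 - a0) * S <= (1 - a0) * (3 * (1 - k)) by rewrite ler_wpM2l //; lra.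
suff: a0 * k + (1 - a0) * (3 * (1 - k)) <= 1 by lra.
have k1 : k <= 1 by have := normr_ge0 s1; lra.
(* As a function of k, the bound a0 k + 3 (1 - a0) (1 - k) has slope 4 a0 - 3; the worst k is 4/7 or
   1 according to its sign. *)
have [?|?] := lerP a0 (3 / 4).
  have : 0 <= (k - 4 / 7) * (3 / 4 - a0) by rewrite mulr_ge0 //; lra.
  lra.
have : 0 <= (1 - k) * (4 * a0 - 3) by rewrite mulr_ge0 //; lra.
lra.
Qed.

(* (k, s) with |s| <= k and k + max_i |s_i| <= 1 is the Bloch vector of a
   positive operator with stabilizer expectations at most 1. *)
Lemma bloch_pairing a0 a1 a2 a3 k s1 s2 s3 :
  0 <= k -> 0 <= a0 -> a1 ^+ 2 + a2 ^+ 2 + a3 ^+ 2 <= a0 ^+ 2 ->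
  s1 ^+ 2 + s2 ^+ 2 + s3 ^+ 2 <= k ^+ 2 ->
  `|a1| <= 1 - a0 -> `|a2| <= 1 - a0 -> `|a3| <= 1 - a0 ->
  `|s1| <= 1 - k -> `|s2| <= 1 - k -> `|s3| <= 1 - k ->
  a0 * k + (a1 * s1 + a2 * s2 + a3 * s3) <= 1.
Proof.
move=> kp a0p ha hs A1 A2 A3 S1 S2 S3.
have k1 : k <= 1 by have := normr_ge0 s1; lra.
have a1' : a0 <= 1 by have := normr_ge0 a1; lra.
have [al|ag] := lerP (7 / 10) a0; first exact: bloch_far.
have [kl|kg] := lerP (7 / 10) k.
  have := @bloch_far k s1 s2 s3 a0 a1 a2 a3 a0p k1 kl ha S1 S2 S3 A1 A2 A3.
  by rewrite mulrC [s1 * _]mulrC [s2 * _]mulrC [s3 * _]mulrC.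
(* Both [a0] and [k] are below 7/10 < 1 / sqrt 2, and Cauchy-Schwarz bounds the left side by 2 a0 k
   < 1. *)
have := bloch_cs a0p kp ha hs; nra.
Qed.

(** Dividing [k] and s by [M] reduces this to [bloch_pairing]; [M] = 0 forces both to vanish. *)
Lemma bloch_pairing_scaled M a0 a1 a2 a3 k s1 s2 s3 :
  0 <= k -> 0 <= a0 -> a1 ^+ 2 + a2 ^+ 2 + a3 ^+ 2 <= a0 ^+ 2 ->
  s1 ^+ 2 + s2 ^+ 2 + s3 ^+ 2 <= k ^+ 2 ->
  `|a1| <= 1 - a0 -> `|a2| <= 1 - a0 -> `|a3| <= 1 - a0 ->
  `|s1| <= M - k -> `|s2| <= M - k -> `|s3| <= M - k ->
  a0 * k + (a1 * s1 + a2 * s2 + a3 * s3) <= M.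
Proof.
move=> kp a0p ha hs A1 A2 A3 S1 S2 S3.
have kM : k <= M by have := normr_ge0 s1; lra.
have : 0 <= M by exact: le_trans kM.
rewrite le_eqVlt => /predU1P[M0|Mp].
  have k0 : k = 0 by lra.
  move: S1 S2 S3; rewrite k0 -M0 subr0 !normr_le0 => /eqP-> /eqP-> /eqP->.
  lra.
have Mi : 0 < M^-1 by rewrite invr_gt0.
have N (s : R) : `|s| <= M - k -> `|s / M| <= 1 - k / M.
  move=> h; rewrite normrM [`|M^-1|]gtr0_norm // -(divff (lt0r_neq0 Mp)).
  by rewrite -mulrBl ler_wpM2r // ltW.
have := @bloch_pairing a0 a1 a2 a3 (k / M) (s1 / M) (s2 / M) (s3 / M).
move=> /(_ (divr_ge0 kp (ltW Mp)) a0p ha).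
rewrite !exprMn -!mulrDl ler_pM2r ?exprn_gt0 // => /(_ hs A1 A2 A3).
move=> /(_ (N _ S1) (N _ S2) (N _ S3)).
rewrite !mulrA -!mulrDl ler_pdivrMr // mul1r; lra.
Qed.
End RealInequality.

(** * One-qubit vectors and their Bloch coordinates *)

Section Complex.
Variable R : realType.
Local Notation C := R[i].
Local Notation toC := (real_complex R).
Implicit Types z w : C.

Definition sqn z : R := complex.Re z ^+ 2 + complex.Im z ^+ 2.

Lemma sqn_ge0 z : 0 <= sqn z.
Proof. by rewrite addr_ge0 ?sqr_ge0. Qed.

Lemma sqnE z : toC (sqn z) = z^* * z.
Proof.
case: z => a b; apply/eqP; rewrite eq_complex /sqn /=.
by apply/andP; split; apply/eqP; ring.
Qed.

Lemma sqn_norm z : `|z| ^+ 2 = toC (sqn z).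
Proof. by rewrite -add_Re2_Im2. Qed.

Lemma sqnM z w : sqn (z * w) = sqn z * sqn w.
Proof. by case: z w => a b [c d]; rewrite /sqn /=; ring. Qed.

Lemma sqnJ z : sqn z^* = sqn z.
Proof. by case: z => a b; rewrite /sqn /=; ring. Qed.

Lemma sqnN z : sqn (- z) = sqn z.
Proof. by case: z => a b; rewrite /sqn /=; ring. Qed.

Lemma sqn_eq0 z : (sqn z == 0) = (z == 0).
Proof. by rewrite /sqn paddr_eq0 ?sqr_ge0 // !sqrf_eq0 eq_complex. Qed.

Lemma sqn0 : sqn 0 = 0. Proof. by apply/eqP; rewrite sqn_eq0. Qed.

Lemma sqn1 : sqn 1 = 1.
Proof. by rewrite /sqn /=; ring. Qed.

Lemma sqn_real (a : R) : sqn (toC a) = a ^+ 2.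
Proof. by rewrite /sqn /=; ring. Qed.

Lemma cabs_sqn z : cabs z = Num.sqrt (sqn z).
Proof. by case: z. Qed.

Lemma cabs_ge0 z : 0 <= cabs z.
Proof. by rewrite cabs_sqn sqrtr_ge0. Qed.

Lemma cabs_sqr z : cabs z ^+ 2 = sqn z.
Proof. by rewrite cabs_sqn sqr_sqrtr // sqn_ge0. Qed.

Lemma cabsM z w : cabs (z * w) = cabs z * cabs w.
Proof. exact: Normc.normcM. Qed.

Lemma cabs_norm z : toC (cabs z) = `|z|. Proof. by []. Qed.

Lemma cabsJ z : cabs z^* = cabs z.
Proof. by rewrite !cabs_sqn sqnJ. Qed.

Lemma cabs0 : cabs (0 : C) = 0.
Proof. by rewrite cabs_sqn sqn0 sqrtr0. Qed.

Lemma cabs_real (a : R) : 0 <= a -> cabs (toC a) = a.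
Proof. by move=> a0; rewrite cabs_sqn sqn_real sqrtr_sqr ger0_norm. Qed.

Lemma cabs_sum (T : finType) (F : T -> C) : cabs (\sum_i F i) <= \sum_i cabs (F i).
Proof.
rewrite -lecR rmorph_sum /= cabs_norm; under [leRHS]eq_bigr do rewrite cabs_norm.
exact: ler_norm_sum.
Qed.

Lemma Re_le_cabs z : complex.Re z <= cabs z.
Proof.
rewrite cabs_sqn (le_trans (ler_norm _)) // -sqrtr_sqr ler_wsqrtr //.
by rewrite /sqn lerDl sqr_ge0.
Qed.

(* Eigenvectors of Z, X, Y, for [t] equal to [None], [Some false] and
   [Some true]; [e] is the sign of the eigenvalue. *)
Definition stab1 (s : option bool * bool) (y : bool) : C :=
  match s.1 with
  | None => (y == s.2)%:R
  | Some b => toC (Num.sqrt (1 / 2)) *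
      (if y then (-1) ^+ s.2 * (if b then 'i else 1) else 1)
  end.

Definition dot (T : finType) (u v : T -> C) : C := \sum_x (u x)^* * v x.

Lemma dotC (T : finType) (u v : T -> C) : (dot u v)^* = dot v u.
Proof. rewrite rmorph_sum; apply: eq_bigr => x _. by rewrite rmorphM /= conjCK mulrC. Qed.

Lemma dot_bool (u v : bool -> C) : dot u v = (u true)^* * v true + (u false)^* * v false.
Proof. by rewrite /dot big_bool. Qed.

(** Coordinates of |v><v| in the Pauli basis: [bl0] goes with I, and [bl] with X, Y, Z for
    [Some false], [Some true], [None]. For a unit vector they are half the usual Bloch
    coordinates. *)
Definition bl0 (v : bool -> C) : R := (sqn (v false) + sqn (v true)) / 2.
Definition bl (t : option bool) (v : bool -> C) : R :=
  let: Complex a b := v false in let: Complex c d := v true in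
  match t with
  | None => (sqn (v false) - sqn (v true)) / 2
  | Some false => a * c + b * d
  | Some true => a * d - b * c
  end.

Lemma sqr_sqrt_half : Num.sqrt (1 / 2) ^+ 2 = 1 / 2 :> R.
Proof. by rewrite sqr_sqrtr // divr_ge0. Qed.

Lemma dot_stab1 s v : sqn (dot v (stab1 s)) = bl0 v + (-1) ^+ s.2 * bl s.1 v.
Proof.
have := sqr_sqrt_half; set h := Num.sqrt _ => hh.
case: s => -[b|] e; rewrite dot_bool /stab1 /= /bl0 /bl /=; last first.
  by case: (v true) (v false) => a1 b1 [c d]; case: e; rewrite /sqn /=; field.
case: (v true) (v false) => a1 b1 [c d].
have h2 : 2^-1 = h ^+ 2 by rewrite hh mul1r.
have h1 : 1 = 2 * h ^+ 2 by rewrite hh mul1r divff // pnatr_eq0.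
case: b; case: e; rewrite /sqn /= -/h h2 -[X in _ = _ + _ * X]mul1r [X in _ = _ + _ * (X * _)]h1; ring.
Qed.

(** The operator |v><v| has determinant zero, so its coordinates lie on the boundary of the light
    cone. *)
Lemma bl_null v : bl None v ^+ 2 + bl (Some false) v ^+ 2 + bl (Some true) v ^+ 2 = bl0 v ^+ 2.
Proof.
rewrite /bl /bl0; case: (v true) (v false) => a b [c d].
by rewrite /sqn /=; field.
Qed.

(** Both sides are the trace of |u><u| |v><v|; the factor 2 is the trace of the identity. *)
Lemma sqn_dot u v : sqn (dot u v) = 2 * (bl0 u * bl0 v + (bl None u * bl None v +
  bl (Some false) u * bl (Some false) v + bl (Some true) u * bl (Some true) v)).
Proof.
rewrite dot_bool /bl /bl0; case: (u true) (u false) => a b [c d].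
by case: (v true) (v false) => a' b' [c' d']; rewrite /sqn /=; field.
Qed.

Lemma bl0_ge0 v : 0 <= bl0 v.
Proof. by rewrite divr_ge0 // addr_ge0 ?sqn_ge0. Qed.

Lemma bl_sum_cone (K : finType) (v : K -> bool -> C) :
  (\sum_k bl None (v k)) ^+ 2 + (\sum_k bl (Some false) (v k)) ^+ 2 +
  (\sum_k bl (Some true) (v k)) ^+ 2 <= (\sum_k bl0 (v k)) ^+ 2.
Proof.
pose P := fun p : R * R * R * R => 0 <= p.1.1.1 /\
  p.1.1.2 ^+ 2 + p.1.2 ^+ 2 + p.2 ^+ 2 <= p.1.1.1 ^+ 2.
suff [] : P (\sum_k bl0 (v k), \sum_k bl None (v k), \sum_k bl (Some false) (v k),
  \sum_k bl (Some true) (v k)) by [].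
elim: (index_enum K) => [|k r [/= IH0 IH]].
  by rewrite !big_nil; split => //=; rewrite !expr0n /= !addr0.
rewrite !big_cons; split=> /=; first by rewrite addr_ge0 ?bl0_ge0.
have hk : bl None (v k) ^+ 2 + bl (Some false) (v k) ^+ 2 + bl (Some true) (v k) ^+ 2 <=
  bl0 (v k) ^+ 2 by rewrite bl_null.
have := bloch_cs (bl0_ge0 (v k)) IH0 hk IH.
have := bl_null (v k); nra.
Qed.

(** With P and V the sums of |g b><g b| and |v k><v k|, the left side is tr (P V). Taking both signs
    in the stabilizer bounds turns them into the coordinate bounds of [bloch_pairing_scaled]. *)
Lemma stab1_pairing (K B : finType) (M : R) (v : K -> bool -> C) (g : B -> bool -> C) :
  (forall s, \sum_b sqn (dot (g b) (stab1 s)) <= 1) ->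
  (forall s, \sum_k sqn (dot (v k) (stab1 s)) <= M) ->
  \sum_b \sum_k sqn (dot (g b) (v k)) <= 2 * M.
Proof.
move=> hg hv.
have N (T : finType) (f : T -> bool -> C) (N : R) t :
    (forall s, \sum_b sqn (dot (f b) (stab1 s)) <= N) ->
    `|\sum_b bl t (f b)| <= N - \sum_b bl0 (f b).
  move=> h; rewrite ler_norml; apply/andP; split.
    have := h (t, true); under eq_bigr do rewrite dot_stab1 /= expr1 mulN1r.
    by rewrite big_split /= sumrN; lra.
  have := h (t, false); under eq_bigr do rewrite dot_stab1 /= expr0 mul1r.
  by rewrite big_split /=; lra.
have -> : \sum_b \sum_k sqn (dot (g b) (v k)) = 2 * (
   (\sum_b bl0 (g b)) * (\sum_k bl0 (v k)) + (
   (\sum_b bl None (g b)) * (\sum_k bl None (v k)) +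
   (\sum_b bl (Some false) (g b)) * (\sum_k bl (Some false) (v k)) +
   (\sum_b bl (Some true) (g b)) * (\sum_k bl (Some true) (v k)))).
  rewrite !big_distrlr /= -!big_split mulr_sumr; apply: eq_bigr => b _.
  rewrite -!big_split mulr_sumr; apply: eq_bigr => k _ /=; exact: sqn_dot.
rewrite ler_pM2l //; apply: bloch_pairing_scaled; rewrite ?N ?sumr_ge0 //.
- by move=> *; exact: bl0_ge0.
- by move=> *; exact: bl0_ge0.
- exact: bl_sum_cone.
- exact: bl_sum_cone.
Qed.
End Complex.

(** * Pauli eigenvectors and contraction of a qubit *)

Section Qcons.
Variable n : nat.
Definition qcons (b : bool) (x : qbasis n) : qbasis n.+1 :=
  [ffun i => if unlift ord0 i is Some j then x j else b].
Definition qhd (x : qbasis n.+1) : bool := x ord0.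
Definition qtl (x : qbasis n.+1) : qbasis n := [ffun i => x (lift ord0 i)].

Lemma qcons0 b x : qcons b x ord0 = b.
Proof. by rewrite ffunE unlift_none. Qed.
Lemma qconsS b x i : qcons b x (lift ord0 i) = x i.
Proof. by rewrite ffunE liftK. Qed.
Lemma qcons_eta x : qcons (qhd x) (qtl x) = x.
Proof.
apply/ffunP => i; have [j ->|->] := unliftP ord0 i; last by rewrite qcons0.
by rewrite qconsS ffunE.
Qed.
Lemma qtlK b x : qtl (qcons b x) = x.
Proof. by apply/ffunP => i; rewrite ffunE qconsS. Qed.

Lemma big_qcons (V : nmodType) (F : qbasis n.+1 -> V) :
  \sum_x F x = \sum_b \sum_x F (qcons b x).
Proof.
rewrite pair_big /= (reindex (fun p => qcons p.1 p.2)) //=.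
exists (fun x => (qhd x, qtl x)) => [[b x] _|x _] /=; last exact: qcons_eta.
by rewrite qtlK /qhd qcons0.
Qed.
End Qcons.

Section Pauli.
Variable R : realType.
Local Notation C := R[i].
Local Notation toC := (real_complex R).

Definition normsq (T : finType) (v : T -> C) : R := \sum_x sqn (v x).

Lemma normsq_ge0 (T : finType) (v : T -> C) : 0 <= normsq v.
Proof. by apply: sumr_ge0 => x _; exact: sqn_ge0. Qed.

Lemma normsq_eq0 (T : finType) (v : T -> C) : normsq v = 0 -> forall x, v x = 0.
Proof.
move=> /eqP; rewrite psumr_eq0 => [/allP h x|x _]; last exact: sqn_ge0.
by apply/eqP; rewrite -sqn_eq0; apply: h; rewrite mem_index_enum.
Qed.

Lemma normsqZ (T : finType) (c : C) (v : T -> C) :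
  normsq (fun x => c * v x) = sqn c * normsq v.
Proof. by rewrite /normsq mulr_sumr; apply: eq_bigr => x _; rewrite sqnM. Qed.

Lemma sqn_sign (b : bool) : sqn ((-1) ^+ b : C) = 1.
Proof. by case: b; rewrite ?expr1 ?sqnN sqn1. Qed.

(** * Pauli strings with a given eigenvector *)

Section Strings.
Variable n : nat.
Implicit Types (a b x : qbasis n) (phi : vec R n).

Definition xorq a b : qbasis n := [ffun i => a i (+) b i].
Definition q0 : qbasis n := [ffun=> false].
Definition zsgn b x : C := \prod_i (-1) ^+ (b i && x i).

(* [pact a b] is the Pauli string X^a Z^b up to a phase. *)
Definition pact a b phi : vec R n := fun x => zsgn b x * phi (xorq x a).
Definition eigp phi a b := exists c, forall x, pact a b phi x = c * phi x.
(** This stands in for the stabilizer group modulo phases. It makes sense for every vector, so an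
    induction can pass through unnormalized contractions without showing that they are stabilizer
    states. *)
Definition eigset phi : {set qbasis n * qbasis n} :=
  [set ab | `[< eigp phi ab.1 ab.2 >]].

Lemma eigsetP phi ab : reflect (eigp phi ab.1 ab.2) (ab \in eigset phi).
Proof. rewrite inE; exact: asboolP. Qed.

Lemma xorqA : associative xorq.
Proof. by move=> a b x; apply/ffunP => i; rewrite !ffunE addbA. Qed.
Lemma xorqC : commutative xorq.
Proof. by move=> a b; apply/ffunP => i; rewrite !ffunE addbC. Qed.
Lemma xorq0 a : xorq a q0 = a.
Proof. by apply/ffunP => i; rewrite !ffunE addbF. Qed.
Lemma xorqq a : xorq a a = q0.
Proof. by apply/ffunP => i; rewrite !ffunE addbb. Qed.
Lemma xorqK a : involutive (xorq^~ a).
Proof. by move=> x; rewrite -xorqA xorqq xorq0. Qed.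
Lemma xorq_eq0 a b : xorq a b = q0 -> a = b.
Proof. by move=> /(congr1 (xorq^~ b)); rewrite xorqK xorqC xorq0. Qed.

Lemma zsgnDl b b' x : zsgn (xorq b b') x = zsgn b x * zsgn b' x.
Proof.
rewrite -big_split; apply: eq_bigr => i _; rewrite ffunE.
by case: (b i); case: (b' i); case: (x i); rewrite /= ?expr0 ?expr1 ?mulrNN ?(mulr1, mul1r).
Qed.
Lemma zsgnDr b x y : zsgn b (xorq x y) = zsgn b x * zsgn b y.
Proof.
rewrite -big_split; apply: eq_bigr => i _; rewrite ffunE.
by case: (b i); case: (x i); case: (y i); rewrite /= ?expr0 ?expr1 ?mulrNN ?(mulr1, mul1r).
Qed.
Lemma sqn_zsgn b x : sqn (zsgn b x) = 1.
Proof.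
rewrite (big_morph (@sqn R) (@sqnM R) (sqn1 R)).
by apply: big1 => i _; exact: sqn_sign.
Qed.

Lemma normsq_pact a b phi : normsq (pact a b phi) = normsq phi.
Proof.
rewrite /normsq; under eq_bigr do rewrite sqnM sqn_zsgn mul1r.
by rewrite [RHS](reindex_inj (inv_inj (xorqK a))).
Qed.

Lemma eig0 phi : (q0, q0) \in eigset phi.
Proof.
apply/eigsetP; exists 1 => x; rewrite /pact /= xorq0 mul1r /zsgn big1 ?mul1r // => i _.
by rewrite ffunE.
Qed.

Lemma card_eigset_gt0 phi : (0 < #|eigset phi|)%N.
Proof. by apply/card_gt0P; exists (q0, q0); exact: eig0. Qed.

Definition xor2 (p q : qbasis n * qbasis n) := (xorq p.1 q.1, xorq p.2 q.2).

Lemma xor2K p : involutive (xor2^~ p).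
Proof. by case: p => a b [a' b']; rewrite /xor2 /= -!xorqA !xorqq !xorq0. Qed.

Lemma xor2_eq0 p q : xor2 p q = (q0, q0) -> p = q.
Proof. by case: p q => a b [a' b'] [/xorq_eq0-> /xorq_eq0->]. Qed.

Lemma eigset_xor phi p q : p \in eigset phi -> q \in eigset phi -> xor2 p q \in eigset phi.
Proof.
case: p q => a b [a' b'] /eigsetP[c /= hc] /eigsetP[c' /= hc']; apply/eigsetP.
have s2 : zsgn b' a * zsgn b' a = 1 by rewrite -zsgnDr xorqq /zsgn big1 // => i _; rewrite ffunE andbF.
exists (zsgn b' a * c' * c) => x; rewrite /= /pact.
have := hc x; have := hc' (xorq x a); rewrite /pact -!xorqA !zsgnDl zsgnDr => h' h.
rewrite -[in RHS]mulrA -h [in RHS]mulrCA -(mulrA _ c') -[c' * _]h'.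
by rewrite -[LHS]mul1r -s2; ring.
Qed.

Lemma eig_sqn phi a b c : normsq phi != 0 ->
  (forall x, pact a b phi x = c * phi x) -> sqn c = 1.
Proof.
move=> nz h; apply: (mulIf nz); rewrite mul1r -normsqZ -[RHS](normsq_pact a b).
by congr normsq; apply/funext.
Qed.
End Strings.

(** * Contraction of the first qubit *)

Section Contraction.
Variable n : nat.
Implicit Types (phi : vec R n.+1).

Definition ctr (s : bool -> C) phi : vec R n := fun x => \sum_y (s y)^* * phi (qcons y x).

(* Symplectic product of the single-qubit Pauli [t] with X^a0 Z^b0. *)
Definition symp (t : option bool) (a0 b0 : bool) : bool :=
  match t with None => a0 | Some false => b0 | Some true => a0 (+) b0 end.

(** The value is dictated by [stab1_pauli]: it is the phase acquired when X^a0 Z^b0 sends one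
    eigenvector of [s.1] to an eigenvector of [s.1]. *)
Definition phase1 (s : option bool * bool) (a0 b0 : bool) : C :=
  (-1) ^+ ((if s.1 is None then s.2 && b0 else (s.2 (+) b0) && a0) : bool) *
  (if (s.1 == Some true) && a0 then 'i else 1).

Lemma sqn_i : sqn ('i : C) = 1.
Proof. by rewrite /sqn /=; ring. Qed.

Lemma sqn_phase1 s a0 b0 : sqn (phase1 s a0 b0) = 1.
Proof. by rewrite sqnM sqn_sign mul1r; case: ifP; rewrite ?sqn_i ?sqn1. Qed.

Lemma stab1_pauli s a0 b0 y :
  (-1) ^+ (b0 && (y (+) a0)) * stab1 R s (y (+) a0) =
  phase1 s a0 b0 * stab1 R (s.1, s.2 (+) symp s.1 a0 b0) y.
Proof.
have ii : 'i * 'i = -1 :> C by rewrite -expr2 sqr_i.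
case: s => [[[]|] e]; rewrite /stab1 /phase1 /=; case: e a0 b0 y => [] [] [] [] /=;
  rewrite ?expr0 ?expr1 ?(mulr1, mul1r, mulN1r, mulr0, opprK, mulNr, mulrN) //.
all: by ring: ii.
Qed.

Lemma zsgn_qcons b0 b y x : zsgn (qcons b0 b) (qcons y x) = (-1) ^+ (b0 && y) * @zsgn n b x.
Proof.
by rewrite /zsgn big_ord_recl !qcons0; congr (_ * _); apply: eq_bigr => i _; rewrite !qconsS.
Qed.

Lemma xorq_qcons a0 a y x : xorq (qcons y x) (qcons a0 a) = qcons (y (+) a0) (@xorq n x a).
Proof.
by apply/ffunP => i; rewrite !ffunE; case: unliftP => [j _|_]; rewrite ?ffunE.
Qed.

(** The first factor of the string is moved onto the bra, where it contributes a phase and flips the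
    sign label if it anticommutes with [s.1]. *)
Lemma ctr_pact s a0 b0 a b phi x :
  ctr (stab1 R s) (pact (qcons a0 a) (qcons b0 b) phi) x =
  (phase1 s a0 b0)^* * pact a b (ctr (stab1 R (s.1, s.2 (+) symp s.1 a0 b0)) phi) x.
Proof.
rewrite /ctr /pact [LHS](reindex_inj (inv_inj (addbK a0))) /= !mulr_sumr.
apply: eq_bigr => y _; rewrite zsgn_qcons xorq_qcons addbK.
move: (stab1_pauli s a0 b0 y); move: (phase1 _ _ _) => w /(congr1 Num.conj).
rewrite !rmorphM rmorphXn rmorphN1 /=; set u := (-1) ^+ _ => h.
by rewrite -!mulrA mulrCA mulrA h; ring.
Qed.

Lemma eigp_ctr s a0 b0 a b phi : symp s.1 a0 b0 = false ->
  eigp phi (qcons a0 a) (qcons b0 b) -> eigp (ctr (stab1 R s) phi) a b.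
Proof.
move=> hs [c hc]; exists (((phase1 s a0 b0)^*)^-1 * c) => x.
have := ctr_pact s a0 b0 a b phi x; rewrite hs addbF -surjective_pairing.
have nz : (phase1 s a0 b0)^* != 0.
  by rewrite -sqn_eq0 sqnJ sqn_phase1 oner_eq0.
move=> h; apply: (mulfI nz); rewrite -h mulrA mulVKf //.
by rewrite /ctr mulr_sumr; apply: eq_bigr => y _; rewrite hc; ring.
Qed.

(** The two eigenvectors of a Pauli form an orthonormal basis; in Bloch coordinates the signed terms
    cancel. *)
Lemma normsq_ctr s phi :
  normsq (ctr (stab1 R s) phi) + normsq (ctr (stab1 R (s.1, ~~ s.2)) phi) = normsq phi.
Proof.
rewrite /normsq big_qcons /= -big_split exchange_big /=; apply: eq_bigr => x _.
set f := fun y => phi (qcons y x).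
have -> : \sum_y sqn (phi (qcons y x)) = 2 * bl0 f by rewrite big_bool /bl0 /f /=; field.
have E u : sqn (ctr u phi x) = sqn (dot f u).
  by rewrite -[RHS]sqnJ dotC.
rewrite !E !dot_stab1 /=; case: s.2; rewrite /= ?expr0 ?expr1; ring.
Qed.

Lemma normsq_ctr_le s phi : normsq (ctr (stab1 R s) phi) <= normsq phi.
Proof. by rewrite -(normsq_ctr s) lerDl normsq_ge0. Qed.

(** A string anticommuting with [s.1] on the first qubit exchanges the two outcomes, which therefore
    have equal norm. *)
Lemma normsq_ctr_half s a0 b0 a b phi : symp s.1 a0 b0 ->
  eigp phi (qcons a0 a) (qcons b0 b) ->
  normsq (ctr (stab1 R s) phi) = normsq phi / 2.
Proof.
move=> hs [c hc].
suff E : normsq (ctr (stab1 R s) phi) = normsq (ctr (stab1 R (s.1, ~~ s.2)) phi).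
  by have := normsq_ctr s phi; rewrite -E => <-; field.
have [z|nz] := eqVneq (normsq phi) 0.
  have := normsq_ctr s phi; rewrite z => /eqP; rewrite paddr_eq0 ?normsq_ge0 //.
  by case/andP => /eqP-> /eqP->.
have hE x : c * ctr (stab1 R s) phi x =
    (phase1 s a0 b0)^* * pact a b (ctr (stab1 R (s.1, ~~ s.2)) phi) x.
  have := ctr_pact s a0 b0 a b phi x; rewrite hs addbT => <-.
  by rewrite /ctr mulr_sumr; apply: eq_bigr => y _; rewrite hc; ring.
have := congr1 (@normsq _) (funext hE).
by rewrite !normsqZ normsq_pact sqnJ sqn_phase1 (eig_sqn nz hc) !mul1r.
Qed.

Definition hd2 (p : qbasis n.+1 * qbasis n.+1) := (qhd p.1, qhd p.2).
Definition tl2 (p : qbasis n.+1 * qbasis n.+1) := (qtl p.1, qtl p.2).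

Lemma hd_tl_inj p q : hd2 p = hd2 q -> tl2 p = tl2 q -> p = q.
Proof.
case: p q => a b [a' b'] [ha hb] [ta tb].
by rewrite -(qcons_eta a) -(qcons_eta b) ha hb ta tb !qcons_eta.
Qed.

Lemma hd2_xor p q : hd2 (xor2 p q) = ((hd2 p).1 (+) (hd2 q).1, (hd2 p).2 (+) (hd2 q).2).
Proof. by rewrite /hd2 /qhd /= !ffunE. Qed.

Lemma tl2_xor p q : tl2 (xor2 p q) = xor2 (tl2 p) (tl2 q).
Proof. by rewrite /tl2 /xor2 /=; congr pair; apply/ffunP => i; rewrite !ffunE. Qed.

Lemma symp_add t a b a' b' : symp t (a (+) a') (b (+) b') = symp t a b (+) symp t a' b'.
Proof. by case: t => [[]|] /=; case: a b a' b' => [] [] [] []. Qed.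

Lemma eigset_qcons phi p : p \in eigset phi ->
  eigp phi (qcons (hd2 p).1 (tl2 p).1) (qcons (hd2 p).2 (tl2 p).2).
Proof. by move=> /eigsetP; rewrite /= !qcons_eta. Qed.

Lemma tl2_eigset s phi p : p \in eigset phi -> symp s.1 (hd2 p).1 (hd2 p).2 = false ->
  tl2 p \in eigset (ctr (stab1 R s) phi).
Proof. by move=> /eigset_qcons h hs; apply/eigsetP; apply: eigp_ctr hs h. Qed.

(* If no nontrivial Pauli on the first qubit stabilizes [phi], then projecting
   that qubit loses at most as many stabilizers as it loses norm. *)
Lemma card_eigset_ctr s phi :
  (forall p, p \in eigset phi -> tl2 p = (q0 n, q0 n) -> hd2 p = (false, false)) ->
  #|eigset phi|%:R * normsq (ctr (stab1 R s) phi) <=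
  normsq phi * #|eigset (ctr (stab1 R s) phi)|%:R.
Proof.
move=> hB; set E := eigset phi.
pose EP := [set p in E | ~~ symp s.1 (hd2 p).1 (hd2 p).2].
(* Two strings with the same tail differ by a Pauli on the first qubit, which is trivial by [hB]. *)
have tl_inj : {in E &, injective tl2}.
  move=> p q pE qE ht; apply: xor2_eq0; apply: hd_tl_inj.
    rewrite (hB _ (eigset_xor pE qE)); first by rewrite /hd2 /qhd /= !ffunE.
    by rewrite tl2_xor ht /xor2 !xorqq.
  rewrite tl2_xor ht /xor2 !xorqq /tl2 /=.
  by congr pair; apply/ffunP => i; rewrite !ffunE.
have cP : (#|EP| <= #|eigset (ctr (stab1 R s) phi)|)%N.
  rewrite -(card_in_imset (f := tl2) (D := EP)); last first.
    by move=> p q; rewrite !inE => /andP[pE _] /andP[qE _]; apply: tl_inj; rewrite inE.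
  apply: subset_leq_card; apply/fintype.subsetP => _ /imsetP[p + ->].
  by rewrite inE => /andP[pE /negbTE hs]; exact: tl2_eigset.
(* If some g anticommutes with [s.1], multiplication by g maps the strings outside [EP] into [EP]:
   at least half of [E] survives while the norm is halved exactly. Otherwise [E] = [EP], and the
   norm cannot grow. *)
have [/existsP[g /andP[gE gs]]|/existsPn noflip] :=
    boolP [exists g, (g \in E) && symp s.1 (hd2 g).1 (hd2 g).2].
  rewrite (normsq_ctr_half gs (eigset_qcons gE)) mulrCA ler_wpM2l ?normsq_ge0 //.
  rewrite ler_pdivrMr // -natrM ler_nat muln2.
  suff : (#|E :\: EP| <= #|EP|)%N.
    move=> h; rewrite -(cardsID EP E) -addnn leq_add //; last exact: leq_trans h cP.
    by apply: leq_trans cP; apply: subset_leq_card; apply: subsetIr.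
  rewrite -(card_in_imset (f := fun p => xor2 p g) (D := E :\: EP)); last first.
    by move=> p q _ _ h; apply: (inv_inj (xor2K g)).
  apply: subset_leq_card; apply/fintype.subsetP => _ /imsetP[p + ->].
  rewrite !inE => /andP[]; rewrite negb_and => hp pE.
  have pE' : p \in E by rewrite inE.
  move: (eigset_xor pE' gE); rewrite inE => ->; rewrite andTb.
  rewrite hd2_xor symp_add gs addbT negbK; move: hp; rewrite pE /=; by rewrite negbK.
have -> : E = EP.
  apply/setP => p; rewrite [in RHS]inE; case: (boolP (p \in E)) => //= pE.
  by have := noflip p; rewrite pE.
by rewrite mulrC ler_pM ?normsq_ge0 ?normsq_ctr_le // ler_nat.
Qed.
End Contraction.
End Pauli.

(** * Product witnesses on stabilizer states *)

Section Fidelity.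
Variable R : realType.
Local Notation C := R[i].
Local Notation toC := (real_complex R).

(** Rank-one pieces of a product operator: qubit j carries the sum of |g j b><g j b| over the two
    values of b, and [B] selects a term in each factor. *)
Definition gten n (g : 'I_n -> bool -> bool -> C) (B : qbasis n) : vec R n :=
  fun x => \prod_j g j (B j) (x j).
(** The expectation in [v] of the operator sum_k |G k><G k|, a form in which positivity is built
    in. *)
Definition wit (K T : finType) (G : K -> T -> C) (v : T -> C) : R := \sum_k sqn (dot (G k) v).

Lemma witZ (K T : finType) (G : K -> T -> C) c v : wit G (fun x => c * v x) = sqn c * wit G v.
Proof.
rewrite /wit mulr_sumr; apply: eq_bigr => k _; rewrite -sqnM; congr sqn.
by rewrite /dot mulr_sumr; apply: eq_bigr => x _; ring.
Qed.

Lemma wit_ge0 (K T : finType) (G : K -> T -> C) v : 0 <= wit G v.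
Proof. by apply: sumr_ge0 => k _; exact: sqn_ge0. Qed.

Section Step.
Variables (n : nat) (g : 'I_n.+1 -> bool -> bool -> C) (phi : vec R n.+1).
Let g' j := g (lift ord0 j).

Lemma dot_qcons (G : vec R n) u :
  dot G (ctr u phi) = dot u (fun y => dot G (fun x => phi (qcons y x))).
Proof.
rewrite /dot /ctr; under eq_bigr do rewrite mulr_sumr.
rewrite exchange_big /=; apply: eq_bigr => y _; rewrite mulr_sumr.
by apply: eq_bigr => x _; ring.
Qed.

Lemma wit_qcons : wit (gten g) phi = \sum_b wit (gten g') (ctr (g ord0 b) phi).
Proof.
rewrite /wit big_qcons; apply: eq_bigr => b _; apply: eq_bigr => B _; congr sqn.
rewrite /dot big_qcons exchange_big /=; apply: eq_bigr => x _.
rewrite /ctr mulr_sumr; apply: eq_bigr => y _.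
rewrite (_ : gten g _ _ = g ord0 b y * gten g' B x) ?rmorphM /=; first by ring.
by rewrite /gten big_ord_recl !qcons0; congr (_ * _); apply: eq_bigr => i _; rewrite !qconsS.
Qed.

Lemma stab1_complete t y y' :
  \sum_e stab1 R (t, e) y * (stab1 R (t, e) y')^* = (y == y')%:R.
Proof.
have := sqr_sqrt_half R; rewrite big_bool /stab1 /=; set h := Num.sqrt _ => hh.
case: t => [[]|]; case: y y' => [] [] /=; apply/eqP; rewrite eq_complex /=;
  apply/andP; split; apply/eqP; lra.
Qed.

Lemma ctr_complete t x y :
  phi (qcons y x) = \sum_e stab1 R (t, e) y * ctr (stab1 R (t, e)) phi x.
Proof.
rewrite /ctr; under eq_bigr do rewrite mulr_sumr; rewrite exchange_big /=.
rewrite [LHS](_ : _ = \sum_y' (y == y')%:R * phi (qcons y' x)); last first.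
  by rewrite big_bool; case: y; rewrite /= ?mul1r ?mul0r ?addr0 ?add0r.
apply: eq_bigr => y' _; rewrite -(stab1_complete t) mulr_suml.
by apply: eq_bigr => e _; ring.
Qed.

Lemma pact0 (v : vec R n) x : pact (q0 n) (q0 n) v x = v x.
Proof.
rewrite /pact xorq0 /zsgn big1 ?mul1r // => i _.
by rewrite ffunE.
Qed.

Lemma phase1N t a0 b0 : symp t a0 b0 = false -> (a0, b0) != (false, false) ->
  phase1 R (t, true) a0 b0 = - phase1 R (t, false) a0 b0.
Proof.
by case: t => [[]|]; case: a0 b0 => [] [] //= _ _; rewrite /phase1 /= ?expr0 ?expr1; ring.
Qed.

(** A Pauli on the first qubit alone multiplies the two contractions by opposite phases. At most one
    of these is the eigenvalue, so the other contraction vanishes. *)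
Lemma ctr_local_eig t a0 b0 : symp t a0 b0 = false -> (a0, b0) != (false, false) ->
  eigp phi (qcons a0 (q0 n)) (qcons b0 (q0 n)) ->
  exists e, forall x, ctr (stab1 R (t, e)) phi x = 0.
Proof.
move=> hs nz [c hc].
have hE e x : c * ctr (stab1 R (t, e)) phi x =
    (phase1 R (t, e) a0 b0)^* * ctr (stab1 R (t, e)) phi x.
  have := ctr_pact (t, e) a0 b0 (q0 n) (q0 n) phi x; rewrite hs addbF pact0 => <-.
  by rewrite /ctr mulr_sumr; apply: eq_bigr => y _; rewrite hc; ring.
have hz e : c != (phase1 R (t, e) a0 b0)^* -> forall x, ctr (stab1 R (t, e)) phi x = 0.
  move=> ne x; apply/eqP; have /eqP := hE e x.
  by rewrite -subr_eq0 -mulrBl mulf_eq0 subr_eq0 (negbTE ne).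
have [E|/hz h] := eqVneq c (phase1 R (t, false) a0 b0)^*; last by exists false.
exists true; apply: hz; rewrite E phase1N // rmorphN /= -subr_eq0 opprK -mulr2n mulrn_eq0 /=.
by rewrite -sqn_eq0 sqnJ sqn_phase1 oner_eq0.
Qed.

Lemma ctr_split t e : (forall x, ctr (stab1 R (t, ~~ e)) phi x = 0) ->
  forall y x, phi (qcons y x) = stab1 R (t, e) y * ctr (stab1 R (t, e)) phi x.
Proof.
move=> h y x; rewrite (ctr_complete t) big_bool.
by case: e h => /= h; rewrite h mulr0 ?addr0 ?add0r.
Qed.
End Step.

(** Every first factor commutes with [s.1], hence is I or [s.1]: one bit beside the tail determines
    the string. *)
Lemma card_eigset_split n (phi : vec R n.+1) s : normsq phi != 0 ->
  (forall p, p \in eigset phi -> symp s.1 (hd2 p).1 (hd2 p).2 = false) ->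
  (#|eigset phi| <= 2 * #|eigset (ctr (stab1 R s) phi)|)%N.
Proof.
move=> nz hs.
pose f (p : qbasis n.+1 * qbasis n.+1) := ((hd2 p).1 || (hd2 p).2, tl2 p).
rewrite -(card_in_imset (f := f) (D := eigset phi)); last first.
  move=> p q pE qE [hpq tpq tpq'].
  apply: hd_tl_inj; last by rewrite /tl2 tpq tpq'.
  move: hpq (hs _ pE) (hs _ qE); rewrite /= /hd2.
  by case: (qhd p.1) (qhd p.2) (qhd q.1) (qhd q.2) s.1 => [] [] [] [] [[]|].
rewrite -card_bool -cardsT -cardsX; apply: subset_leq_card; apply/fintype.subsetP.
by move=> _ /imsetP[p pE ->]; rewrite /f finset.in_setX finset.in_setT /=; apply: tl2_eigset (hs p pE).
Qed.

(** Induction on the qubits: the factor 2 gained on the right pays for the eigenstrings lost under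
    contraction, or for the one-qubit pairing bound. *)
Lemma stab_fidelity n (g : 'I_n -> bool -> bool -> C) (phi : vec R n) :
  (forall j s, wit (g j) (stab1 R s) <= 1) ->
  #|eigset phi|%:R * wit (gten g) phi <= 2 ^+ n * normsq phi.
Proof.
elim: n => [|n IH] in g phi *.
  move=> _.
  have q0E (x : qbasis 0) : x = q0 0 by apply/ffunP => -[].
  have -> : #|eigset phi| = 1%N.
    apply/eqP/cards1P; exists (q0 0, q0 0); apply/setP => -[a b].
    by rewrite finset.in_set1 (q0E a) (q0E b) eig0 eqxx.
  rewrite mul1r expr0 mul1r /wit /normsq.
  apply: ler_sum => x _; rewrite (_ : dot _ _ = phi x) // /dot (bigD1 x) //= big1 => [|y].
    by rewrite /gten big_ord0 rmorph1 mul1r addr0.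
  by rewrite (q0E x) (q0E y) eqxx.
move=> hg.
pose g' j := g (lift ord0 j); have hg' j s : wit (g' j) (stab1 R s) <= 1 by exact: hg.
have [z|nz] := eqVneq (normsq phi) 0.
  rewrite z mulr0 (_ : wit _ _ = 0) ?mulr0 // /wit big1 // => B _.
  rewrite /dot big1 ?sqn0 // => x _.
  by rewrite (normsq_eq0 z) mulr0.
have Np : 0 < normsq phi by rewrite lt_def nz normsq_ge0.
have Ep : 0 < #|eigset phi|%:R :> R by rewrite ltr0n card_eigset_gt0.
(* Either the first qubit splits off as a Pauli eigenstate, or no nontrivial Pauli on it alone is an
   eigenstring and [card_eigset_ctr] applies. *)
have [/existsP[p /and3P[pE /eqP pt ph]]|/existsPn hB] :=
    boolP [exists p, [&& p \in eigset phi, tl2 p == (q0 n, q0 n) & hd2 p != (false, false)]].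
  have [t ts] : exists t, symp t (hd2 p).1 (hd2 p).2 = false.
    move: ph; case: (hd2 p) => -[] [] //= _; last by exists None.
      by exists (Some true).
    by exists (Some false).
  have [e0 he] : exists e, forall x, ctr (stab1 R (t, e)) phi x = 0.
    apply: (ctr_local_eig ts); first by rewrite -surjective_pairing.
    by have := eigset_qcons pE; rewrite pt.
  pose e := ~~ e0; pose s := (t, e).
  have sp : forall y x, phi (qcons y x) = stab1 R s y * ctr (stab1 R s) phi x.
    by apply: ctr_split => x; rewrite negbK.
  have Ns : normsq (ctr (stab1 R s) phi) = normsq phi.
    rewrite -[RHS](normsq_ctr s) /= negbK [X in _ = _ + X](_ : _ = 0) ?addr0 //.
    by rewrite /normsq big1 // => x _; rewrite he sqn0.
  have hs q : q \in eigset phi -> symp s.1 (hd2 q).1 (hd2 q).2 = false.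
    move=> qE; apply/negP => hq; have := normsq_ctr_half hq (eigset_qcons qE).
    by rewrite Ns; lra.
  have W : wit (gten g) phi = wit (g ord0) (stab1 R s) * wit (gten g') (ctr (stab1 R s) phi).
    rewrite wit_qcons [wit (g ord0) _]/wit mulr_suml; apply: eq_bigr => b _.
    rewrite -witZ; congr wit; apply/funext => x; rewrite /ctr /dot mulr_suml.
    by apply: eq_bigr => y _; rewrite sp /ctr; ring.
  have := IH _ (ctr (stab1 R s) phi) hg'; rewrite Ns => ih.
  have W1 : wit (gten g) phi <= wit (gten g') (ctr (stab1 R s) phi).
    by rewrite W -[leRHS]mul1r ler_wpM2r ?wit_ge0.
  have hc := card_eigset_split nz hs.
  apply: (@le_trans _ _ ((2 * #|eigset (ctr (stab1 R s) phi)|)%:R * wit (gten g') (ctr (stab1 R s) phi))).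
    by rewrite ler_pM ?wit_ge0 ?ler_nat.
  by rewrite natrM exprS -!mulrA ler_pM2l.
have hB' p : p \in eigset phi -> tl2 p = (q0 n, q0 n) -> hd2 p = (false, false).
  move=> pE pt; apply/eqP; have := hB p; rewrite pE pt eqxx /=; by rewrite negbK.
(* [M] will bound, for every s, the remaining witness on the contraction by [stab1 R s]. *)
pose M := 2 ^+ n * normsq phi / #|eigset phi|%:R.
suff : wit (gten g) phi <= 2 * M.
  move=> h; rewrite exprS -mulrA mulrC -ler_pdivlMr // mulrA.
  by move: h; rewrite /M !mulrA.
rewrite wit_qcons.
(* [v B] is the vector left on the first qubit when the others are contracted with piece [B] of
   their witness. *)
pose v (B : qbasis n) y := dot (gten g' B) (fun x => phi (qcons y x)).
have -> : \sum_b wit (gten g') (ctr (g ord0 b) phi) = \sum_b \sum_B sqn (dot (g ord0 b) (v B)).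
  by apply: eq_bigr => b _; apply: eq_bigr => B _; rewrite dot_qcons.
apply: stab1_pairing => [s|s]; first exact: hg.
have -> : \sum_k sqn (dot (v k) (stab1 R s)) = wit (gten g') (ctr (stab1 R s) phi).
  by apply: eq_bigr => B _; rewrite dot_qcons -sqnJ dotC.
have h1 := IH _ (ctr (stab1 R s) phi) hg'.
have h2 := card_eigset_ctr s hB'.
have Esp : 0 < #|eigset (ctr (stab1 R s) phi)|%:R :> R by rewrite ltr0n card_eigset_gt0.
rewrite /M ler_pdivlMr // mulrC -(ler_pM2l Esp).
apply: (@le_trans _ _ (#|eigset phi|%:R * (2 ^+ n * normsq (ctr (stab1 R s) phi)))).
  by rewrite mulrCA ler_pM2l.
rewrite mulrCA [leRHS]mulrCA ler_pM2l ?exprn_gt0 //.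
by rewrite [leRHS]mulrC.
Qed.

Lemma expi_inj : injective (fun k : 'I_4 => 'i ^+ k : C).
Proof.
move=> [[|[|[|[|k]]]] lk] // [[|[|[|[|k']]]] lk'] //= /eqP;
  rewrite eq_complex /= => /andP[/eqP h1 /eqP h2]; try exact: val_inj; exfalso; lra.
Qed.

Definition xbit (p : 'I_4) : bool := (val p == 1%N) || (val p == 2).
Definition zbit (p : 'I_4) : bool := (val p == 2) || (val p == 3).

(* An element of the stabilizer group is determined by its Pauli string, its
   phase being fixed by the nonzero vector [phi]. *)
Lemma stab_eigset n (phi : vec R n) : stab_state phi -> (2 ^ n <= #|eigset phi|)%N.
Proof.
move=> [u [S [[_ _ _ _ cS] hS]]]; rewrite -cS.
have [x0 nz] : exists x, phi x != 0.
  apply/existsP; apply: contraT => /existsPn h.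
  move: u; rewrite /unit_vec big1 => [/eqP|x _]; first by rewrite eq_sym oner_eq0.
  by have := h x; rewrite negbK => /eqP->; rewrite normr0 expr0n.
(* With X applied before Z, the matrix Y equals -i Z X. *)
pose ph (p : 'I_4) : C := if val p == 2 then - 'i else 1.
have P1 p x y : pauli1 R p x y = ph p * (-1) ^+ (zbit p && x) * (y == x (+) xbit p)%:R.
  rewrite /pauli1 /ph /zbit /xbit.
  by case: p => [[|[|[|[|p]]]] lp] //; case: x y => [] [] /=; rewrite ?expr0 ?expr1; ring.
pose xs (s : {ffun 'I_n -> 'I_4}) : qbasis n := [ffun i => xbit (s i)].
pose zs (s : {ffun 'I_n -> 'I_4}) : qbasis n := [ffun i => zbit (s i)].
have phnz p : ph p != 0.
  by rewrite /ph; case: ifP; rewrite ?oner_eq0 // oppr_eq0 -sqn_eq0 sqn_i oner_eq0.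
pose F (s : {ffun 'I_n -> 'I_4}) := \prod_i ph (s i).
have Fnz s : F s != 0 by apply/prodf_neq0 => i _.
have act (a : plabel n) x : opapp (pauli_op R a) phi x =
    'i ^+ a.1 * (F a.2 * pact (xs a.2) (zs a.2) phi x).
  rewrite /opapp (bigD1 (xorq x (xs a.2))) //= big1 ?addr0 => [|y ny].
    rewrite /pauli_op /pact /F /zsgn -!mulrA; congr (_ * _); rewrite mulrA -big_split /=; congr (_ * _).
    apply: eq_bigr => i _; rewrite P1 !ffunE eqxx mulr1; congr (_ * _).
  have [i hi] : exists i, y i != xorq x (xs a.2) i.
    apply/existsP; apply: contraNT ny => /existsPn h; apply/eqP/ffunP => i.
    by apply/eqP; have := h i; rewrite negbK.
  rewrite /pauli_op (bigD1 i) //= P1; move: hi; rewrite !ffunE => /negbTE ->.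
  by rewrite !(mulr0, mul0r).
have eqn a x : a \in S -> 'i ^+ a.1 * (F a.2 * pact (xs a.2) (zs a.2) phi x) = phi x.
  by move=> aS; rewrite -act hS.
have inz k : 'i ^+ k != 0 :> C by rewrite expf_neq0 // -sqn_eq0 sqn_i oner_eq0.
pose f (a : plabel n) := (xs a.2, zs a.2).
rewrite -(card_in_imset (f := f) (D := S)); last first.
  move=> [k s] [k' s'] aS bS [/ffunP hx /ffunP hz].
  have es : s = s'.
    apply/ffunP => i; have := hx i; have := hz i; rewrite !ffunE /xbit /zbit.
    case: (s i) => [[|[|[|[|k1]]]] lk1] //; case: (s' i) => [[|[|[|[|k2]]]] lk2] //= _ _;
      exact: val_inj.
  subst s'; congr pair; have := eqn _ x0 aS; rewrite -[in X in _ = X -> _](eqn _ x0 bS) /=.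
  have tnz : F s * pact (xs s) (zs s) phi x0 != 0.
    by apply: contra nz => /eqP h; rewrite -(eqn _ x0 aS) /= h mulr0.
  by move=> /(mulIf tnz) /expi_inj.
apply: subset_leq_card; apply/fintype.subsetP => _ /imsetP[a aS ->]; apply/eigsetP.
exists ('i ^+ a.1 * F a.2)^-1 => x; rewrite -(eqn a x aS) [X in _ = _ * X]mulrA mulKf //.
by rewrite mulf_neq0.
Qed.

(** At least 2^n eigenstrings are available, which cancels the factor 2^n in [stab_fidelity]. *)
Lemma stab_wit_le1 n (g : 'I_n -> bool -> bool -> C) (phi : vec R n) :
  (forall j s, wit (g j) (stab1 R s) <= 1) -> stab_state phi -> wit (gten g) phi <= 1.
Proof.
move=> hg hphi; have hE := stab_eigset hphi; have := stab_fidelity phi hg.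
have -> : normsq phi = 1.
  apply: (@complexI R); rewrite rmorph_sum rmorph1 -(hphi.1) /=.
  by apply: eq_bigr => x _; rewrite sqn_norm.
rewrite mulr1 => h; have p2 : 0 < 2 ^+ n :> R by rewrite exprn_gt0.
rewrite -(ler_pM2l p2) mulr1; apply: le_trans h; rewrite ler_wpM2r ?wit_ge0 //.
by rewrite -natrX ler_nat.
Qed.
End Fidelity.

(** * Products of one-qubit stabilizer states *)

Section ProductStab.
Variable R : realType.
Local Notation C := R[i].
Local Notation toC := (real_complex R).

Lemma dot_bigA n (F : 'I_n -> bool -> C) :
  \sum_(z : qbasis n) \prod_j F j (z j) = \prod_j \sum_b F j b.
Proof. by rewrite bigA_distr_bigA. Qed.

Definition pauli_of (t : option bool) : 'I_4 :=
  match t with None => inord 3 | Some false => inord 1 | Some true => inord 2 end.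

Lemma pauli1E t a b : pauli1 R (pauli_of t) a b =
  match t with
  | None => if a == b then (if a then -1 else 1) else 0
  | Some false => if a == b then 0 else 1
  | Some true => if a == b then 0 else (if a then 'i else - 'i)
  end.
Proof. by case: t => [[]|]; rewrite /pauli1 /pauli_of /= inordK. Qed.

(** The order-two group fixing [stab1 R s], indexed by a bit under xor: the identity and a signed
    Pauli. *)
Definition stabilizer1 (s : option bool * bool) (b : bool) (x y : bool) : C :=
  (-1) ^+ (b && s.2) * pauli1 R (if b then pauli_of s.1 else ord0) x y.

Lemma stabilizer1M s b b' x y :
  \sum_z stabilizer1 s b x z * stabilizer1 s b' z y = stabilizer1 s (b (+) b') x y.
Proof.
have ii : 'i * 'i = -1 :> C by rewrite -expr2 sqr_i.
rewrite big_bool /stabilizer1; case: s => t e; case: b b' => [] [] /=; rewrite ?pauli1E /pauli1 /=.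
all: case: t => [[]|]; case: e x y => [] [] [] /=; rewrite ?expr0 ?expr1; by ring: ii.
Qed.

Lemma stabilizer1_fix s b x : \sum_z stabilizer1 s b x z * stab1 R s z = stab1 R s x.
Proof.
have ii : 'i * 'i = -1 :> C by rewrite -expr2 sqr_i.
rewrite big_bool /stabilizer1 /stab1; case: s => t e; case: b => /=; rewrite ?pauli1E /pauli1 /=.
all: case: t => [[]|]; case: e x => [] [] /=; rewrite ?expr0 ?expr1; by ring: ii.
Qed.

Lemma stab1_unit s : \sum_x sqn (stab1 R s x) = 1.
Proof.
have := sqr_sqrt_half R; rewrite big_bool /stab1 /sqn; set h := Num.sqrt _ => hh.
by case: s => -[[]|] [] /=; rewrite -?/h ?expr0 ?expr1 /=; lra.
Qed.

Section Product.
Variables (n : nat) (g : 'I_n -> option bool * bool).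
Definition pstab : vec R n := fun x => \prod_j stab1 R (g j) (x j).

(** The signs of the factors multiply to 1 or -1, hence the exponent 0 or 2 of i. *)
Definition plab (B : qbasis n) : plabel n :=
  (if \big[addb/false]_q (B q && (g q).2) then inord 2 else ord0,
   [ffun q => if B q then pauli_of (g q).1 else ord0]).

Lemma plabE B x y : pauli_op R (plab B) x y = \prod_q stabilizer1 (g q) (B q) (x q) (y q).
Proof.
rewrite /pauli_op /stabilizer1 big_split /=; congr (_ * _); last first.
  by apply: eq_bigr => q _; rewrite ffunE.
have M : {morph (fun b : bool => (-1) ^+ b : C) : b b' / b (+) b' >-> b * b'}.
  by move=> [] [] /=; rewrite ?expr0 ?expr1; ring.
rewrite -(big_morph (fun b : bool => (-1) ^+ b : C) M (expr0 (-1) : (-1) ^+ false = 1)); case: ifP => _.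
  by rewrite inordK // sqr_i.
by [].
Qed.

Lemma opmul_plab B B' x y :
  opmul (pauli_op R (plab B)) (pauli_op R (plab B')) x y = pauli_op R (plab (xorq B B')) x y.
Proof.
rewrite /opmul plabE; under [LHS]eq_bigr do rewrite !plabE -big_split.
rewrite (dot_bigA (fun q z => stabilizer1 (g q) (B q) (x q) z * stabilizer1 (g q) (B' q) z (y q))).
by apply: eq_bigr => q _; rewrite stabilizer1M ffunE.
Qed.

Lemma pauli_of_neq0 t : pauli_of t != ord0.
Proof. by case: t => [[]|]; apply/eqP => /(congr1 val); rewrite /= inordK. Qed.

Lemma plab_inj : injective plab.
Proof.
move=> B B' [_ /ffunP h]; apply/ffunP => q; have := h q; rewrite !ffunE.
by case: (B q); case: (B' q) => // /eqP; rewrite ?(negbTE (pauli_of_neq0 _)) // eq_sym (negbTE (pauli_of_neq0 _)).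
Qed.

Lemma plab0 : plab (q0 n) = plabel_id n.
Proof.
rewrite /plab big1 => [|q _]; last by rewrite ffunE.
by congr pair; apply/ffunP => q; rewrite !ffunE.
Qed.

(** [plab] carries xor of bit strings to the operator product and is injective, so its image is the
    required group of order 2^n. *)
Lemma pstab_stab : stab_state pstab.
Proof.
split.
  rewrite /unit_vec; under eq_bigr do rewrite sqn_norm (big_morph (@sqn R) (@sqnM R) (sqn1 R)) rmorph_prod.
  rewrite (dot_bigA (fun q z => toC (sqn (stab1 R (g q) z)))) big1 // => q _.
  by rewrite -rmorph_sum stab1_unit rmorph1.
exists [set plab B | B in [set: qbasis n]]; split; last first.
  move=> _ /imsetP[B _ ->] x; rewrite /opapp; under eq_bigr do rewrite plabE -big_split.
  rewrite (dot_bigA (fun q z => stabilizer1 (g q) (B q) (x q) z * stab1 R (g q) z)).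
  by apply: eq_bigr => q _; rewrite stabilizer1_fix.
split.
- by apply/imsetP; exists (q0 n); rewrite ?plab0 ?finset.in_setT.
- move=> _ _ /imsetP[B _ ->] /imsetP[B' _ ->]; exists (plab (xorq B B')).
    by apply: imset_f; rewrite finset.in_setT.
  by move=> x y; rewrite opmul_plab.
- move=> _ /imsetP[B _ ->]; exists (plab B); first by apply: imset_f; rewrite finset.in_setT.
  by move=> x y; rewrite opmul_plab xorqq plab0.
- by move=> _ _ /imsetP[B _ ->] /imsetP[B' _ ->] x y; rewrite !opmul_plab xorqC.
- by rewrite card_imset; [rewrite cardsT card_ffun card_bool card_ord | exact: plab_inj].
Qed.
End Product.

(** Computational basis states suffice. This makes the set defining the extent nonempty, as needed
    to bound its infimum from below. *)
Lemma stab_span n (psi : vec R n) : exists (T : finType) (c : T -> C) (phi : T -> vec R n),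
  (forall j, stab_state (phi j)) /\ forall x, psi x = \sum_j c j * phi j x.
Proof.
exists (qbasis n), psi, (fun y : qbasis n => pstab (fun q => (None, y q))); split=> [y|x].
  exact: pstab_stab.
rewrite (bigD1 x) //= big1 => [|y].
  by rewrite /pstab big1 ?mulr1 ?addr0 // => q _; rewrite /stab1 /= eqxx.
move=> ny; have [i hi] : exists i, y i != x i.
  apply/existsP; apply: contraNT ny => /existsPn h; apply/eqP/ffunP => i.
  by apply/eqP; have := h i; rewrite negbK.
rewrite /pstab (bigD1 i) //= /stab1 /= eq_sym (negbTE hi).
by rewrite mul0r mulr0.
Qed.
End ProductStab.

(** * Decompositions certified by a witness *)

Section Certificate.
Variable R : realType.
Local Notation C := R[i].
Local Notation toC := (real_complex R).

(** Exact values of the infima come from a feasible point whose value is also a lower bound. *)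
Lemma inf_min (S : set R) v : S v -> lbound S v -> inf S = v.
Proof.
move=> Sv lb; apply/eqP; rewrite eq_le; apply/andP; split.
  by apply: ge_inf => //; exists v.
by apply: lb_le_inf => //; exists v.
Qed.

Lemma sum_enum (V : nmodType) (T : finType) (F : T -> V) :
  \sum_(i < #|T|) F (enum_val i) = \sum_t F t.
Proof. by rewrite -(big_enum_val (A := T) F). Qed.

Lemma cabs_re (x : R) (z : C) : toC x = z -> x <= cabs z.
Proof. by move=> <-; rewrite (le_trans _ (Re_le_cabs _)). Qed.

Lemma wcauchy (T : finType) (w s : T -> R) : (forall i, 0 <= w i) ->
  (\sum_i w i * s i) ^+ 2 <= (\sum_i w i) * \sum_i w i * s i ^+ 2.
Proof.
move=> w0; rewrite -subr_ge0.
suff -> : (\sum_i w i) * (\sum_i w i * s i ^+ 2) - (\sum_i w i * s i) ^+ 2 =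
    \sum_i \sum_j w i * w j * (s i - s j) ^+ 2 / 2.
  by apply: sumr_ge0 => i _; apply: sumr_ge0 => j _; rewrite divr_ge0 // mulr_ge0 ?sqr_ge0 // mulr_ge0.
pose A := \sum_i \sum_j w i * (w j * s j ^+ 2).
have A1 : (\sum_i w i) * (\sum_i w i * s i ^+ 2) = A by rewrite big_distrlr.
have A2 : (\sum_i w i) * (\sum_i w i * s i ^+ 2) = \sum_i \sum_j (w j * (w i * s i ^+ 2)).
  by rewrite A1 /A exchange_big.
have B1 : (\sum_i w i * s i) ^+ 2 = \sum_i \sum_j (w i * s i) * (w j * s j).
  by rewrite expr2 big_distrlr.
transitivity (((\sum_i w i) * (\sum_i w i * s i ^+ 2)) / 2
  + ((\sum_i w i) * (\sum_i w i * s i ^+ 2)) / 2 - (\sum_i w i * s i) ^+ 2).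
  by field.
rewrite {1}A1 A2 B1 /A !mulr_suml -sumrN -!big_split; apply: eq_bigr => i _ /=.
rewrite !mulr_suml -sumrN -!big_split; apply: eq_bigr => j _ /=.
by field.
Qed.

Variables (n : nat) (K : finType) (G : K -> vec R n).
Hypothesis W1 : forall phi, stab_state phi -> wit G phi <= 1.

(** The form <u|W|w> of the witness W = sum_k |G k><G k|. *)
Definition bil (u w : vec R n) : C := \sum_k (dot (G k) u)^* * dot (G k) w.

Lemma bil_diag u : bil u u = toC (wit G u).
Proof. by rewrite rmorph_sum; apply: eq_bigr => k _; rewrite /= sqnE. Qed.

Lemma dot_sumr (T : finType) (u : vec R n) (c : T -> C) (f : T -> vec R n) :
  dot u (fun x => \sum_j c j * f j x) = \sum_j c j * dot u (f j).
Proof.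
rewrite /dot; under eq_bigr do rewrite mulr_sumr.
rewrite exchange_big; apply: eq_bigr => j _; rewrite mulr_sumr.
by apply: eq_bigr => x _ /=; ring.
Qed.

(** Positivity of W lets diagonal entries dominate the others; termwise, 2 |a| |b| <= |a|^2 +
    |b|^2. *)
Lemma bil_le1 u w : stab_state u -> stab_state w -> cabs (bil u w) <= 1.
Proof.
move=> /W1 hu /W1 hw; rewrite (le_trans (cabs_sum _)) //.
apply: (@le_trans _ _ ((wit G u + wit G w) / 2)); last by lra.
rewrite /wit -big_split mulr_suml; apply: ler_sum => k _; rewrite cabsM cabsJ /= -!cabs_sqr.
have := sqr_ge0 (cabs (dot (G k) u) - cabs (dot (G k) w)); lra.
Qed.

(** In the expansion of <psi|W|psi> each entry of W has modulus at most 1, which leaves the squared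
    l1 norm. *)
Lemma wit_le_span (T : finType) (c : T -> C) (phi : T -> vec R n) :
  (forall j, stab_state (phi j)) ->
  wit G (fun x => \sum_j c j * phi j x) <= (\sum_j cabs (c j)) ^+ 2.
Proof.
move=> hs; set psi := fun x => _.
have E : toC (wit G psi) = \sum_i \sum_j (c i)^* * c j * bil (phi i) (phi j).
  rewrite -bil_diag /bil.
  under eq_bigr do rewrite !dot_sumr rmorph_sum big_distrlr.
  rewrite exchange_big; apply: eq_bigr => i _; rewrite exchange_big; apply: eq_bigr => j _.
  by rewrite mulr_sumr; apply: eq_bigr => k _; rewrite /= rmorphM /=; ring.
rewrite (le_trans (cabs_re E)) // (le_trans (cabs_sum _)) //.
rewrite expr2 big_distrlr; apply: ler_sum => i _; rewrite (le_trans (cabs_sum _)) //.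
apply: ler_sum => j _; rewrite !cabsM cabsJ.
by rewrite -[leRHS]mulr1 ler_wpM2l ?mulr_ge0 ?cabs_ge0 ?bil_le1.
Qed.

Lemma wit_le_extent psi : wit G psi <= extent psi.
Proof.
apply: lb_le_inf.
  have [T [c [phi [hs hE]]]] := stab_span psi.
  exists ((\sum_(j < #|T|) cabs (c (enum_val j))) ^+ 2), #|T|, (c \o enum_val), (phi \o enum_val).
  split=> // [j|x]; first exact: hs.
  by rewrite hE -sum_enum.
move=> _ [k [c [phi [hs hE ->]]]].
by rewrite (_ : psi = fun x => \sum_j c j * phi j x) ?wit_le_span //; apply/funext.
Qed.

Definition quad (A : op R n) (v : vec R n) : C := \sum_x \sum_y (v x)^* * A x y * v y.
(** The trace of W A. *)
Definition trw (A : op R n) : C := \sum_k quad A (G k).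

Lemma quad_dyad (T : finType) (al : T -> C) (L Q : T -> vec R n) (A : op R n) v :
  (forall x y, A x y = \sum_j al j * dyad (L j) (Q j) x y) ->
  quad A v = \sum_j al j * (dot v (L j) * dot (Q j) v).
Proof.
move=> hA; rewrite /quad.
under eq_bigr do under eq_bigr do rewrite hA mulr_sumr mulr_suml.
under eq_bigr do rewrite exchange_big.
rewrite exchange_big; apply: eq_bigr => j _ /=.
rewrite /dot big_distrlr mulr_sumr; apply: eq_bigr => x _.
by rewrite mulr_sumr; apply: eq_bigr => y _; rewrite /dyad /=; ring.
Qed.

Lemma trw_dyad (T : finType) (al : T -> C) (L Q : T -> vec R n) (A : op R n) :
  (forall x y, A x y = \sum_j al j * dyad (L j) (Q j) x y) ->
  trw A = \sum_j al j * bil (Q j) (L j).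
Proof.
move=> hA; rewrite /trw /bil; under [RHS]eq_bigr do rewrite mulr_sumr.
rewrite [RHS]exchange_big; apply: eq_bigr => k _ /=.
by rewrite (quad_dyad _ hA); apply: eq_bigr => j _; congr (_ * _); rewrite dotC mulrC.
Qed.

Lemma quad_affine l (A A' : op R n) v :
  quad (fun x y => l * A x y - A' x y) v = l * quad A v - quad A' v.
Proof.
rewrite /quad mulr_sumr -sumrB; apply: eq_bigr => x _.
by rewrite mulr_sumr -sumrB; apply: eq_bigr => y _; ring.
Qed.

(** * Monotones of a state whose decomposition matches the witness *)

Variables (A B : finType) (p : A -> R) (c : A -> B -> C) (phi : B -> vec R n).
Variables (rho : op R n) (t : R).
Let psi a : vec R n := fun x => \sum_b c a b * phi b x.
Hypotheses (p0 : forall a, 0 <= p a) (p1 : \sum_a p a = 1).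
Hypothesis phi_stab : forall b, stab_state (phi b).
Hypothesis psi_unit : forall a, unit_vec (psi a).
Hypothesis rhoE : forall x y, rho x y = \sum_a toC (p a) * dyad (psi a) (psi a) x y.
Hypothesis t_gt0 : 0 < t.
Hypothesis cE : forall a, \sum_b cabs (c a b) = t.
Hypothesis wit_psi : forall a, wit G (psi a) = t ^+ 2.

Lemma extent_psi a : extent (psi a) = t ^+ 2.
Proof.
apply: inf_min.
  exists #|B|, (c a \o enum_val), (phi \o enum_val); split=> [j|x|] /=.
  - exact: phi_stab.
  - by rewrite (sum_enum (fun b => c a b * phi b x)).
  - by rewrite (sum_enum (fun b => cabs (c a b))) cE.
move=> _ [k [c' [phi' [hs hE ->]]]]; rewrite -(wit_psi a).
by rewrite (_ : psi a = fun x => \sum_j c' j * phi' j x) ?wit_le_span //; apply/funext.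
Qed.

Lemma trw_rho : trw rho = toC (t ^+ 2).
Proof.
rewrite (trw_dyad rhoE); under eq_bigr do rewrite bil_diag wit_psi.
by rewrite -mulr_suml -rmorph_sum p1 rmorph1 mul1r.
Qed.

Lemma cert_decomp : pure_decomp rho (fun i : 'I_#|A| => p (enum_val i)) (fun i => psi (enum_val i)).
Proof.
split=> [j||j|x y] //=; first by rewrite sum_enum.
by rewrite rhoE (sum_enum (fun a => toC (p a) * dyad (psi a) (psi a) x y)).
Qed.

(** For the lower bound, tr (W rho) = t^2 is an average of values <psi'|W|psi'>, each at most the
    extent of psi'. *)
Lemma cert_mixed_extent : mixed_extent rho = t ^+ 2.
Proof.
apply: inf_min.
  exists #|A|, (fun i => p (enum_val i)), (fun i => psi (enum_val i)); split; first exact: cert_decomp.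
  by under eq_bigr do rewrite /= extent_psi; rewrite -mulr_suml sum_enum p1 mul1r.
move=> _ [k [p' [psi' [[p'0 p'1 _ hE] ->]]]].
rewrite -lecR -trw_rho (trw_dyad hE) rmorph_sum; apply: ler_sum => j _.
by rewrite bil_diag -rmorphM lecR ler_wpM2l ?wit_le_extent.
Qed.

Lemma cert_equimagical : equimagical rho.
Proof.
exists #|A|, (fun i => p (enum_val i)), (fun i => psi (enum_val i)); split; first exact: cert_decomp.
  rewrite cert_mixed_extent; under eq_bigr do rewrite /= extent_psi.
  by rewrite -mulr_suml sum_enum p1 mul1r.
by move=> i j /=; rewrite !extent_psi.
Qed.

(** Expanding each |psi a><psi a| gives dyads of total weight t^2. Conversely tr (W rho) = t^2
    combines entries of W of modulus at most 1. *)
Lemma cert_dyadic : dyadic_neg rho = t ^+ 2.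
Proof.
apply: inf_min.
  pose al (i : A * (B * B)) := toC (p i.1) * (c i.1 i.2.1 * (c i.1 i.2.2)^*).
  exists #|{: A * (B * B)}|, (al \o enum_val), (fun i => phi (enum_val i).2.1),
    (fun i => phi (enum_val i).2.2); split=> // [x y|].
    rewrite rhoE (sum_enum (fun i => al i * dyad (phi i.2.1) (phi i.2.2) x y)).
    rewrite -(pair_bigA _ (fun a b => al (a, b) * dyad (phi b.1) (phi b.2) x y)) /=.
    apply: eq_bigr => a _; rewrite -(pair_bigA _ (fun b b' => al (a, (b, b')) * dyad (phi b) (phi b') x y)) /=.
    rewrite /dyad /psi rmorph_sum big_distrlr mulr_sumr; apply: eq_bigr => b _.
    rewrite mulr_sumr; apply: eq_bigr => b' _; rewrite /al /= rmorphM /=; ring.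
  rewrite (sum_enum (fun i => cabs (al i))).
  rewrite -(pair_bigA _ (fun a b => cabs (al (a, b)))) /=.
  rewrite -[LHS]mul1r -p1 mulr_suml; apply: eq_bigr => a _.
  rewrite -(pair_bigA _ (fun b b' => cabs (al (a, (b, b'))))) /= -(cE a) expr2 big_distrlr mulr_sumr.
  apply: eq_bigr => b _; rewrite mulr_sumr; apply: eq_bigr => b' _.
  by rewrite /al /= !cabsM cabsJ cabs_real.
move=> _ [k [al [L [Q [hL hQ hE ->]]]]].
have := cabs_re (esym trw_rho); rewrite (trw_dyad hE) => /le_trans; apply.
rewrite (le_trans (cabs_sum _)) //; apply: ler_sum => j _.
by rewrite cabsM -[leRHS]mulr1 ler_wpM2l ?cabs_ge0 ?bil_le1.
Qed.

Lemma cert_gen_rob : gen_rob rho = t ^+ 2.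
Proof.
apply: inf_min.
  (* The dominating state mixes the [phi b] with weights |c a b| / t. Weighted Cauchy-Schwarz gives
     |<v|psi a>|^2 <= t sum_b |c a b| |<v|phi b>|^2, that is, rho <= t^2 tau. *)
  pose q (i : A * B) := p i.1 * (cabs (c i.1 i.2) / t).
  pose tau : op R n := fun x y => \sum_i toC (q i) * dyad (phi i.2) (phi i.2) x y.
  exists tau; split.
    exists #|{: A * B}|, (q \o enum_val), (fun i => phi (enum_val i).2); split=> // [j||x y] /=.
    - by rewrite /q mulr_ge0 // divr_ge0 ?cabs_ge0 // ltW.
    - rewrite sum_enum -(pair_bigA _ (fun a b => q (a, b))) /= -[RHS]p1.
      apply: eq_bigr => a _; rewrite /q /= -mulr_sumr -mulr_suml cE divff ?mulr1 //.
      by rewrite gt_eqF.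
    - by rewrite (sum_enum (fun i => toC (q i) * dyad (phi i.2) (phi i.2) x y)).
  move=> v.
  have sqE (u : vec R n) : dot v u * dot u v = toC (sqn (dot v u)).
    by rewrite sqnE dotC mulrC.
  rewrite -/(quad _ v) quad_affine (quad_dyad v (A := tau) (fun x y => erefl)) (quad_dyad v rhoE).
  have -> : toC (t ^+ 2) * (\sum_i toC (q i) * (dot v (phi i.2) * dot (phi i.2) v)) -
      \sum_a toC (p a) * (dot v (psi a) * dot (psi a) v) =
     toC (\sum_a p a * (t * \sum_b cabs (c a b) * sqn (dot v (phi b)) - sqn (dot v (psi a)))).
    rewrite -(pair_bigA _ (fun a b => toC (q (a, b)) * (dot v (phi b) * dot (phi b) v))) /=.
    rewrite mulr_sumr -sumrB rmorph_sum; apply: eq_bigr => a _.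
    rewrite [RHS]rmorphM rmorphB [X in _ = _ * (X - _)]rmorphM rmorph_sum /= mulrBr sqE; congr (_ - _).
    rewrite !mulr_sumr; apply: eq_bigr => b _; rewrite sqE -!(rmorphM (real_complex R)).
    by congr (real_complex R _); rewrite /q /=; field; rewrite gt_eqF.
  rewrite ler0c; apply: sumr_ge0 => a _; rewrite mulr_ge0 // subr_ge0.
  rewrite dot_sumr -cabs_sqr -(cE a).
  apply: (@le_trans _ _ ((\sum_b cabs (c a b) * cabs (dot v (phi b))) ^+ 2)).
    rewrite ler_pXn2r ?nnegrE ?cabs_ge0 ?sumr_ge0 // => [|b _]; last by rewrite mulr_ge0 ?cabs_ge0.
    by rewrite (le_trans (cabs_sum _)) //; apply: ler_sum => b _; rewrite cabsM.
  apply: le_trans (wcauchy _ _) _ => [b|]; first exact: cabs_ge0.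
  by under [X in _ * X]eq_bigr do rewrite cabs_sqr.
move=> l [sigma [[k [q [f [q0 q1 hf hE]]]] hpsd]].
(* Pairing l sigma - rho with W gives t^2 <= l tr (W sigma), where tr (W sigma) <= 1. *)
have : 0 <= trw (fun x y => toC l * sigma x y - rho x y).
  by apply: sumr_ge0 => k' _; exact: hpsd.
have -> : trw (fun x y => toC l * sigma x y - rho x y) = toC l * trw sigma - trw rho.
  by rewrite /trw mulr_sumr -sumrB; apply: eq_bigr => k' _; exact: quad_affine.
rewrite trw_rho (trw_dyad hE); under eq_bigr do rewrite bil_diag -rmorphM.
rewrite -rmorph_sum -rmorphM -rmorphB ler0c subr_ge0 => h.
have s1 : \sum_i q i * wit G (f i) <= 1.
  rewrite -q1; apply: ler_sum => j _; by rewrite -[leRHS]mulr1 ler_wpM2l ?W1.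
have s0 : 0 <= \sum_i q i * wit G (f i).
  by apply: sumr_ge0 => j _; rewrite mulr_ge0 ?wit_ge0.
have t2 : 0 < t ^+ 2 by rewrite exprn_gt0.
have l0 : 0 < l.
  rewrite ltNge; apply/negP => l0; have := le_lt_trans (mulr_le0_ge0 l0 s0) t2.
  by move: h; lra.
by rewrite (le_trans h) // -[leRHS]mulr1 ler_wpM2l // ltW.
Qed.
End Certificate.

(** * Decomposition of Bloch vectors *)

Section BlochDecomposition.
Variable R : rcfType.
Implicit Types (x y z : R).

(* [u] is the Bloch vector of the witness and [w] holds the signed weights of
   the stabilizer states; w_i u_i = |w_i| tau says that these weights sit on
   stabilizer states of maximal overlap with the witness. *)
Definition bloch_cert x y z : Prop :=
  exists m w1 w2 w3 u1 u2 u3 tau : R,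
  [/\ 0 < m,
    [/\ x = (1 + m) * w1 + m * u1, y = (1 + m) * w2 + m * u2 & z = (1 + m) * w3 + m * u3],
    `|w1| + `|w2| + `|w3| = 1 /\ u1 ^+ 2 + u2 ^+ 2 + u3 ^+ 2 = 1,
    [/\ `|u1| <= tau, `|u2| <= tau & `|u3| <= tau] &
    [/\ w1 * u1 = `|w1| * tau, w2 * u2 = `|w2| * tau & w3 * u3 = `|w3| * tau]].

Lemma bloch_cert_flip x y z : bloch_cert x y z -> bloch_cert (- x) y z.
Proof.
move=> [m [w1 [w2 [w3 [u1 [u2 [u3 [tau [m0 [-> -> ->] [hw hu] [h1 h2 h3] [e1 e2 e3]]]]]]]]]].
exists m, (- w1), w2, w3, (- u1), u2, u3, tau; rewrite !normrN sqrrN mulrNN.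
by split=> //; split=> //; ring.
Qed.

Lemma bloch_cert_swap12 x y z : bloch_cert x y z -> bloch_cert y x z.
Proof.
move=> [m [w1 [w2 [w3 [u1 [u2 [u3 [tau [m0 [e1 e2 e3] [hw hu] [h1 h2 h3] [g1 g2 g3]]]]]]]]]].
exists m, w2, w1, w3, u2, u1, u3, tau; split=> //.
by rewrite [`|w2| + _]addrC [u2 ^+ 2 + _]addrC.
Qed.

Lemma bloch_cert_swap23 x y z : bloch_cert x y z -> bloch_cert x z y.
Proof.
move=> [m [w1 [w2 [w3 [u1 [u2 [u3 [tau [m0 [e1 e2 e3] [hw hu] [h1 h2 h3] [g1 g2 g3]]]]]]]]]].
exists m, w1, w3, w2, u1, u3, u2, tau; split=> //.
by rewrite addrAC hw addrAC hu.
Qed.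

Lemma bloch_cert_abs1 x y z : bloch_cert `|x| y z -> bloch_cert x y z.
Proof.
have [x0|x0] := ger0P x; first by [].
by move=> /bloch_cert_flip; rewrite opprK.
Qed.

Lemma bloch_cert_abs x y z : bloch_cert `|x| `|y| `|z| -> bloch_cert x y z.
Proof.
move=> /bloch_cert_abs1/bloch_cert_swap12/bloch_cert_abs1/bloch_cert_swap23.
move=> /bloch_cert_swap12/bloch_cert_abs1 h.
exact: (bloch_cert_swap12 (bloch_cert_swap23 (bloch_cert_swap12 h))).
Qed.

(** Here u = (1, 1, 1) / sqrt 3, and m is fixed by |w|_1 = 1. The last hypothesis says exactly that
    the smallest weight, that of y, is nonnegative. *)
Lemma bloch_cert_three x y z : 0 <= y -> y <= x -> y <= z -> 1 < x + y + z ->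
  x + z - 1 <= (2 + Num.sqrt 3) * y -> bloch_cert x y z.
Proof.
move=> y0 yx yz L1; have := sqrtr_ge0 (3 : R).
have : Num.sqrt 3 ^+ 2 = 3 :> R by rewrite sqr_sqrtr.
set s := Num.sqrt 3 => s2 s0 hA.
have sp : 0 < s by rewrite lt_def s0 andbT; apply/eqP => h; move: s2; rewrite h; lra.
pose m := (x + y + z - 1) / (s + 1); pose u := s / 3.
have s1 : 0 < s + 1 by lra.
have m0 : 0 < m by rewrite divr_gt0 //; lra.
have mE : m * (s + 1) = x + y + z - 1 by rewrite divfK // gt_eqF.
have yu : m * u <= y.
  rewrite -(ler_pM2r s1) /u; have -> : m * (s / 3) * (s + 1) = (x + y + z - 1) * s / 3.
    by rewrite -mE; field.
  have : (x + z - 1) * s <= (2 + s) * y * s by rewrite ler_pM2r.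
  have : s * s = 3 by rewrite -expr2.
  by move=> ss; have -> : (2 + s) * y * s = 2 * y * s + y * (s * s) by [ring]; rewrite ss; lra.
have v0 : 0 < 1 + m by lra.
pose w r := (r - m * u) / (1 + m).
have wp r : y <= r -> 0 <= w r by move=> h; rewrite divr_ge0 ?(ltW v0) //; lra.
have wE r : r = (1 + m) * w r + m * u by rewrite /w; field; rewrite gt_eqF.
exists m, (w x), (w y), (w z), u, u, u, u.
have u0 : 0 <= u by rewrite divr_ge0.
rewrite !ger0_norm ?wp //; split=> //; split.
  apply: (mulfI (lt0r_neq0 v0)).
  have -> : (1 + m) * (w x + w y + w z) = x + y + z - 3 * (m * u).
    by rewrite !mulrDr /w; field; rewrite gt_eqF.
  by rewrite /u; lra.
by rewrite /u; have -> : (s / 3) ^+ 2 + (s / 3) ^+ 2 + (s / 3) ^+ 2 = s ^+ 2 / 3 by [field]; rewrite s2; field.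
Qed.

(** In the remaining range the weight of y is zero, so y = m u2, and u = (t, y / m, t) with tau = t.
    The other weights sum to 1 when 2 m t = A - m. *)
Lemma bloch_cert_two x y z : 0 <= y -> y <= x -> y <= z -> x <= 1 -> z <= 1 -> 1 < x + y + z ->
  (2 + Num.sqrt 3) * y <= x + z - 1 -> bloch_cert x y z.
Proof.
move=> y0 yx yz x1 z1 L1; have := sqrtr_ge0 (3 : R).
have : Num.sqrt 3 ^+ 2 = 3 :> R by rewrite sqr_sqrtr.
set s := Num.sqrt 3 => s2 s0; set A := x + z - 1 => hA.
have sy : 0 <= s * y by rewrite mulr_ge0.
have A0 : 0 < A by rewrite /A in hA *; lra.
(* The root m of m^2 + 2 A m = A^2 + 2 y^2 makes u = (t, y / m, t) a unit vector. *)
pose B := Num.sqrt (2 * A ^+ 2 + 2 * y ^+ 2); pose m := B - A.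
have B2 : B ^+ 2 = 2 * A ^+ 2 + 2 * y ^+ 2.
  by have := sqr_ge0 A; have := sqr_ge0 y => h1 h2; rewrite sqr_sqrtr //; lra.
have B0 : 0 <= B by exact: sqrtr_ge0.
have m0 : 0 < m.
  rewrite subr_gt0 -(@ltr_pXn2r _ 2) ?nnegrE ?(ltW A0) // B2.
  have : 0 < A ^+ 2 by rewrite exprn_gt0.
  have := sqr_ge0 y; lra.
(* Divided by 2 m, this is u2 <= tau. *)
have mu : 2 * y <= A - m.
  have hB : B <= 2 * A - 2 * y.
    have g : 0 <= 2 * A - 2 * y by lra.
    rewrite -(@ler_pXn2r _ 2) ?nnegrE // B2.
    have : (s * y) ^+ 2 <= (A - 2 * y) ^+ 2.
      by rewrite ler_pXn2r ?nnegrE //; lra.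
    by rewrite exprMn s2; lra.
  by rewrite /m; lra.
have mE : m ^+ 2 + 2 * A * m = A ^+ 2 + 2 * y ^+ 2.
  by rewrite /m; have -> : (B - A) ^+ 2 + 2 * A * (B - A) = B ^+ 2 - A ^+ 2 by [ring]; rewrite B2; ring.
pose t := (A - m) / (2 * m); have mn : m != 0 by rewrite gt_eqF.
have ut : y / m <= t.
  by rewrite /t invfM mulrA ler_pM2r ?invr_gt0 //; lra.
have u0 : 0 <= y / m by rewrite divr_ge0 // ltW.
have v0 : 0 < 1 + m by lra.
have vn : 1 + m != 0 by rewrite gt_eqF.
pose w r := (r - (A - m) / 2) / (1 + m).
have wx : 0 <= w x by rewrite divr_ge0 ?(ltW v0) //; rewrite /A; lra.
have wz : 0 <= w z by rewrite divr_ge0 ?(ltW v0) //; rewrite /A; lra.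
exists m, (w x), 0, (w z), t, (y / m), t, t.
have t0 : 0 <= t by exact: le_trans ut.
rewrite normr0 !mul0r !ger0_norm //; split=> //; split.
- by rewrite /w /t; field; rewrite mn vn.
- by field.
- by rewrite /w /t; field; rewrite mn vn.
- by rewrite /w /A; field.
- have -> : t ^+ 2 + (y / m) ^+ 2 + t ^+ 2 = ((A ^+ 2 + 2 * y ^+ 2) + m ^+ 2 - 2 * A * m) / (2 * m ^+ 2).
    by rewrite /t; field.
  by rewrite -mE; field.
Qed.

Lemma bloch_certP x y z : `|x| <= 1 -> `|y| <= 1 -> `|z| <= 1 ->
  1 < `|x| + `|y| + `|z| -> bloch_cert x y z.
Proof.
move=> x1 y1 z1 L; apply: bloch_cert_abs.
move: (normr_ge0 x) (normr_ge0 y) (normr_ge0 z) x1 y1 z1 L.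
move: `|x| `|y| `|z| => {x y z} x y z x0 y0 z0 x1 y1 z1 L.
have K a b c : 0 <= b -> b <= a -> b <= c -> a <= 1 -> c <= 1 -> 1 < a + b + c -> bloch_cert a b c.
  move=> b0 ba bc a1 c1 l; have [h|h] := lerP (a + c - 1) ((2 + Num.sqrt 3) * b).
    exact: bloch_cert_three.
  by apply: bloch_cert_two => //; exact: ltW.
have [xy|yx] := lerP x y.
  have [xz|zx] := lerP x z; first by apply: bloch_cert_swap12; apply: K => //; lra.
  by apply: bloch_cert_swap23; apply: K => //; lra.
have [yz|zy] := lerP y z; first by apply: K => //; lra.
by apply: bloch_cert_swap23; apply: K => //; lra.
Qed.
End BlochDecomposition.

(** * One-qubit certificates *)

Section SingleQubit.
Variable R : realType.
Local Notation C := R[i].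
Local Notation toC := (real_complex R).
Local Notation pauli := (option bool).
Local Notation vec1 := (bool -> C).

Definition psi1 (A : Type) (c : A -> pauli * bool -> C) (a : A) : vec1 :=
  fun y => \sum_s c a s * stab1 R s y.

(* [t] is the square root of the common value of the monotones, [p] and [c]
   give the equimagical decomposition, and [g] the witness sum_b |g b><g b|. *)
Definition cert1 (S : bool -> bool -> C) (t : R) (p : bool * bool -> R)
    (c : bool * bool -> pauli * bool -> C) (g : bool -> vec1) : Prop :=
  [/\ 0 < t, (forall a, 0 <= p a) /\ \sum_a p a = 1,
    (forall a, normsq (psi1 c a) = 1) /\
    (forall y y', S y y' = \sum_a toC (p a) * (psi1 c a y * (psi1 c a y')^*)),
    forall a, \sum_s cabs (c a s) = t &
    (forall s, wit g (stab1 R s) <= 1) /\ (forall a, wit g (psi1 c a) = t ^+ 2)].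

(** The matrix k I + x X + y Y + z Z. *)
Definition bmat (k x y z : R) (a b : bool) : C :=
  if a then (if b then Complex (k - z) 0 else Complex x y)
  else (if b then Complex x (- y) else Complex (k + z) 0).

Lemma bmatE (v : vec1) a b :
  v a * (v b)^* = bmat (bl0 v) (bl (Some false) v) (bl (Some true) v) (bl None v) a b.
Proof.
rewrite /bl /bl0; case E : (v true) => [c d]; case E' : (v false) => [c' d'].
by case: a b => [] []; rewrite ?E ?E' /sqn /=; apply/eqP; rewrite eq_complex /=;
  apply/andP; split; apply/eqP; field.
Qed.

Lemma bl0_stab1 s : bl0 (stab1 R s) = 1 / 2.
Proof. by rewrite /bl0 -(stab1_unit R s) big_bool addrC. Qed.

Lemma bl_stab1 t s : bl t (stab1 R s) = if s.1 == t then (-1) ^+ s.2 / 2 else 0.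
Proof.
have := sqr_sqrt_half R; rewrite /bl /stab1; set h := Num.sqrt _ => hh.
case: s => -[[]|] e; case: t => [[]|]; case: e; rewrite /sqn /=; try rewrite -/h; lra.
Qed.

Lemma bloch_of_state (S : bool -> bool -> C) :
  (forall v : vec1, 0 <= \sum_a \sum_b (v a)^* * S a b * v b) ->
  \sum_a S a a = 1 ->
  exists x y z, (forall a b, S a b = bmat (1 / 2) (x / 2) (y / 2) (z / 2) a b) /\
    forall v, 0 <= bl0 v + (x * bl (Some false) v + y * bl (Some true) v + z * bl None v).
Proof.
move=> psdS trS; pose ket u w : vec1 := fun b => if b then w else u.
(* Nonnegativity in [C] includes being real; on these four vectors it makes [S] Hermitian. *)
have := psdS (ket 1 0); have := psdS (ket 0 1); have := psdS (ket 1 1); have := psdS (ket 1 'i).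
move: trS; rewrite !big_bool /ket /= !lecE /=.
case E1 : (S true true) => [a a']; case E2 : (S true false) => [b b'].
case E3 : (S false true) => [c c']; case E4 : (S false false) => [d d'].
move=> /eqP; rewrite eq_complex /= => /andP[/eqP t1 /eqP t2].
move=> /andP[/eqP h1 _] /andP[/eqP h2 _] /andP[/eqP h3 _] /andP[/eqP h4 _].
have [x [y [z SE]]] : exists x y z, forall a b, S a b = bmat (1 / 2) (x / 2) (y / 2) (z / 2) a b.
  exists (b * 2), (b' * 2), (d - a).
  by move=> [] []; rewrite ?E1 ?E2 ?E3 ?E4 /bmat /=; apply/eqP; rewrite eq_complex /=;
    apply/andP; split; apply/eqP; lra.
exists x, y, z; split=> // v; have := psdS v; rewrite lecE => /andP[_].
rewrite !big_bool !SE /bmat /bl0 /bl; case: (v true) (v false) => e e' [f f']; rewrite /sqn /=.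
by move=> h; apply: le_trans h _; rewrite le_eqVlt; apply/orP; left; apply/eqP; field.
Qed.

Lemma bloch_le1 x y z :
  (forall v : vec1, 0 <= bl0 v + (x * bl (Some false) v + y * bl (Some true) v + z * bl None v)) ->
  [/\ `|x| <= 1, `|y| <= 1 & `|z| <= 1].
Proof.
move=> h; split; rewrite ler_norml.
- have := h (stab1 R (Some false, false)); have := h (stab1 R (Some false, true)).
  by rewrite !bl0_stab1 !bl_stab1 /= expr1 expr0 => *; apply/andP; split; lra.
- have := h (stab1 R (Some true, false)); have := h (stab1 R (Some true, true)).
  by rewrite !bl0_stab1 !bl_stab1 /= expr1 expr0 => *; apply/andP; split; lra.
- have := h (stab1 R (None, false)); have := h (stab1 R (None, true)).
  by rewrite !bl0_stab1 !bl_stab1 /= expr1 expr0 => *; apply/andP; split; lra.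
Qed.

Lemma sign_abs (x : R) : (-1) ^+ (x < 0)%R * `|x| = x.
Proof.
case: (ltrP x 0) => h; first by rewrite ltr0_norm // expr1; ring.
by rewrite ger0_norm // expr0 mul1r.
Qed.

Definition ket (b : bool) : vec1 := fun y => (b == y)%:R.

Lemma dot_ket b (v : vec1) : dot (ket b) v = v b.
Proof. by rewrite dot_bool /ket; case: b; rewrite /= ?rmorph1 ?rmorph0; ring. Qed.

Lemma wit_ket (v : vec1) : wit ket v = normsq v.
Proof. by apply: eq_bigr => b _; rewrite dot_ket. Qed.

Lemma cert1_octahedron x y z : `|x| + `|y| + `|z| <= 1 ->
  exists t p c g, cert1 (bmat (1 / 2) (x / 2) (y / 2) (z / 2)) t p c g.
Proof.
(* The slack d is shared equally by the two eigenvectors of Y, which leaves the Bloch vector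
   unchanged. The witness is the identity. *)
move=> L; pose d := 1 - (`|x| + `|y| + `|z|).
pose pt (a : bool * bool) : pauli * bool :=
  if a.1 then (Some true, (y < 0) (+) a.2) else if a.2 then (Some false, x < 0) else (None, z < 0).
pose p (a : bool * bool) : R :=
  if a.1 then (if a.2 then d / 2 else `|y| + d / 2) else if a.2 then `|x| else `|z|.
pose c (a : bool * bool) s : C := (s == pt a)%:R.
have psiE a : psi1 c a = stab1 R (pt a).
  apply/funext => b; rewrite /psi1 (bigD1 (pt a)) //= /c eqxx mul1r big1 ?addr0 // => s.
  by move=> /negbTE ->; rewrite mul0r.
exists 1, p, c, ket.
have d0 : 0 <= d by rewrite /d; lra.
have bigp (V : nmodType) (f : bool * bool -> V) : \sum_a f a =
    f (true, true) + f (true, false) + (f (false, true) + f (false, false)).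
  transitivity (\sum_a \sum_b f (a, b)); last by rewrite !big_bool.
  by rewrite pair_bigA; apply: eq_bigr => -[].
split=> //.
- split=> [[[] []]|]; rewrite /p /=; do ?[by []|by lra].
    have := normr_ge0 y; lra.
  by rewrite bigp /= /d; field.
- split=> [a|a b]; first by rewrite psiE; exact: stab1_unit.
  rewrite bigp !psiE !bmatE !bl0_stab1 !bl_stab1 /pt /p /= addbT addbF.
  have := sign_abs x; have := sign_abs y; have := sign_abs z; move: d0; rewrite /d.
  rewrite signrN; set sx := (-1) ^+ (x < 0)%R; set sy := (-1) ^+ (y < 0)%R; set sz := (-1) ^+ (z < 0)%R.
  move=> _ hz hy hx; case: a b => [] []; apply/eqP; rewrite eq_complex /=;
    apply/andP; split; apply/eqP; lra.
- move=> a; rewrite (bigD1 (pt a)) //= /c eqxx big1 ?addr0 => [|s /negbTE->]; last exact: cabs0.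
  by rewrite cabs_sqn sqn1 sqrtr1.
- split=> [s|a]; first by rewrite wit_ket /normsq stab1_unit.
  by rewrite wit_ket psiE expr1n /normsq stab1_unit.
Qed.

(** In dimension two the complement of the kernel vector is a line, so M is its trace times the
    projector onto that line. *)
Lemma herm_ker (M : bool -> bool -> C) (om : vec1) : (forall a b, M a b = (M b a)^*) ->
  (forall a, \sum_b M a b * om b = 0) -> normsq om = 1 ->
  forall a b, M a b = (M true true + M false false) * ((a == b)%:R - om a * (om b)^*).
Proof.
move=> hM h0 N; have := h0 true; have := h0 false; rewrite !big_bool.
set m := M true true; set k := M false false; set l := M true false.
rewrite (hM false true) -/l.
have mJ : m^* = m by rewrite -hM. have kJ : k^* = k by rewrite -hM.
have N' : om true * (om true)^* + om false * (om false)^* = 1.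
  have := congr1 toC N; rewrite rmorph1 rmorph_sum big_bool /= !sqnE => <-; ring.
set u := om true in N' *; set w := om false in N' * => h2 h1.
have h1J := congr1 Num.conj h1; have h2J := congr1 Num.conj h2.
rewrite rmorphD !rmorphM rmorph0 /= mJ in h1J; rewrite rmorphD !rmorphM rmorph0 /= kJ conjCK in h2J.
have e1 : m * (u * u^*) = k * (w * w^*).
  apply/eqP; rewrite -subr_eq0; apply/eqP.
  rewrite (_ : _ - _ = (m * u + l * w) * u^* - w * (l * u^* + k * w^*)); last by ring.
  by rewrite h1 h2J; ring.
have e2 : l = - (m + k) * (u * w^*).
  rewrite -[LHS]mulr1 -N' (_ : _ * _ = u * (l * u^* + k * w^*) + w^* * (m * u + l * w) - (m + k) * (u * w^*)); last by ring.
  by rewrite h1 h2J; ring.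
move=> [] []; rewrite -?/m -?/k -?/l ?(hM false true) -?/l -?/u -?/w /=.
- rewrite -[X in X - _]N' (_ : _ - _ = w * w^*); last by ring.
  by rewrite mulrDl -e1 -mulrDr addrC N' mulr1.
- by rewrite e2; ring.
- by rewrite e2 rmorphM rmorphN rmorphD /= mJ kJ rmorphM /= conjCK; ring.
- rewrite -[X in X - _]N' (_ : _ - _ = u * u^*); last by ring.
  by rewrite mulrDl e1 -mulrDr addrC N' mulr1.
Qed.
End SingleQubit.

(** * Superpositions of stabilizer states aligned with a pure state *)

Section Face.
Variable R : realType.
Local Notation C := R[i].
Local Notation toC := (real_complex R).
Local Notation pauli := (option bool).
Local Notation vec1 := (bool -> C).

Lemma conj_real (x : R) : (toC x)^* = toC x.
Proof. exact: conjc_real. Qed.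

(** Such an f is the squared norm along a line of vectors; the intermediate value theorem for
    polynomials applies. *)
Lemma quad_ivt (a b h s0 s1 : R) : s0 <= s1 ->
  let f s := (1 - s) ^+ 2 * a + s ^+ 2 * b + 2 * s * (1 - s) * h in
  (f s0 <= 1 /\ 1 <= f s1) \/ (1 <= f s0 /\ f s1 <= 1) ->
  exists2 s, s0 <= s <= s1 & f s = 1.
Proof.
move=> s01 f.
pose P : {poly R} := (1 - 'X) ^+ 2 * a%:P + 'X ^+ 2 * b%:P + 2%:P * 'X * (1 - 'X) * h%:P - 1.
have PE s : P.[s] = f s - 1 by rewrite /P /f !hornerE.
case=> -[h0 h1].
  have [|s hs /rootP] := @poly_ivt R P _ _ s01; first by rewrite !PE; apply/andP; split; lra.
  by rewrite PE => E; exists s => //; lra.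
have [|s hs /rootP] := @poly_ivt R (- P) _ _ s01.
  by rewrite !hornerN !PE; apply/andP; split; lra.
by rewrite hornerN PE => E; exists s => //; lra.
Qed.

Variables (om : vec1) (ep : pauli -> bool) (F v : R).
Hypotheses (om1 : normsq om = 1) (F0 : 0 < F) (v1 : 1 < v).
Hypothesis om_stab : forall s, sqn (dot om (stab1 R s)) <= F.

Let e t := stab1 R (t, ep t).
Let r := Num.sqrt v / Num.sqrt F.

(* [face_psi q] is sqrt v times the [q]-average of the [e t], with their phases
   chosen so that the overlaps with [om] are equal to sqrt F. *)
Definition face_coef (q : pauli -> R) (s : pauli * bool) : C :=
  if s.2 == ep s.1 then toC (r * q s.1) * dot (stab1 R s) om else 0.
Definition face_psi q : vec1 := fun y => \sum_s face_coef q s * stab1 R s y.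

(** Points of a simplex; the last clause allows weight only on eigenvectors whose fidelity with [om]
    is exactly [F]. *)
Definition face_pt (q : pauli -> R) : Prop :=
  [/\ forall t, 0 <= q t, \sum_t q t = 1 & forall t, q t * (sqn (dot (e t) om) - F) = 0].

Lemma big_sign (V : nmodType) (f : pauli * bool -> V) :
  (forall s, s.2 != ep s.1 -> f s = 0) -> \sum_s f s = \sum_t f (t, ep t).
Proof.
move=> h; transitivity (\sum_t \sum_b f (t, b)); first by rewrite pair_bigA; apply: eq_bigr => -[].
apply: eq_bigr => t _; rewrite (bigD1 (ep t)) //= big1 ?addr0 // => b.
by move=> nb; apply: h.
Qed.

Lemma face_psiE q y : face_psi q y = \sum_t toC (r * q t) * (dot (e t) om * e t y).
Proof.
rewrite /face_psi big_sign => [|s /negbTE ns]; last by rewrite /face_coef ns mul0r.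
by apply: eq_bigr => t _; rewrite /face_coef /= eqxx -mulrA.
Qed.

Lemma v_gt0 : 0 < v. Proof. exact: lt_trans ltr01 v1. Qed.
Lemma sqrtv : Num.sqrt v ^+ 2 = v. Proof. by rewrite sqr_sqrtr // ltW ?v_gt0. Qed.
Lemma sqrtF : Num.sqrt F ^+ 2 = F. Proof. by rewrite sqr_sqrtr // ltW. Qed.
Lemma sqrtv0 : 0 < Num.sqrt v. Proof. by rewrite sqrtr_gt0 v_gt0. Qed.
Lemma sqrtF0 : 0 < Num.sqrt F. Proof. by rewrite sqrtr_gt0. Qed.

Lemma face_fid q t : face_pt q -> q t * sqn (dot (e t) om) = q t * F.
Proof. by move=> [_ _ /(_ t)]; rewrite mulrBr => /eqP; rewrite subr_eq0 => /eqP. Qed.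

Lemma face_om q : face_pt q -> dot om (face_psi q) = toC (Num.sqrt v * Num.sqrt F).
Proof.
move=> hq; have [_ q1 _] := hq.
have -> : dot om (face_psi q) = \sum_t toC (r * q t) * toC (sqn (dot (e t) om)).
  rewrite {1}/dot; under eq_bigr do rewrite face_psiE mulr_sumr.
  rewrite exchange_big; apply: eq_bigr => t _ /=.
  rewrite sqnE dotC; set k := dot (e t) om; transitivity (toC (r * q t) * k * dot om (e t)); last by ring.
  by rewrite /dot mulr_sumr; apply: eq_bigr => y _; ring.
have E t : toC (r * q t) * toC (sqn (dot (e t) om)) = toC (Num.sqrt v * Num.sqrt F * q t).
  rewrite -rmorphM; congr (real_complex R _); rewrite -[LHS]mulrA face_fid // /r -{2}sqrtF; field.
  by rewrite gt_eqF ?sqrtF0.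
by under eq_bigr do rewrite E; rewrite -rmorph_sum -mulr_sumr q1 mulr1.
Qed.

Lemma face_coef_norm q : face_pt q -> \sum_s cabs (face_coef q s) = Num.sqrt v.
Proof.
move=> hq; have [q0 q1 _] := hq.
rewrite big_sign => [|s /negbTE ns]; last by rewrite /face_coef ns cabs0.
rewrite -[RHS]mulr1 -q1 mulr_sumr; apply: eq_bigr => t _.
rewrite /face_coef /= eqxx cabsM cabs_real; last first.
  by rewrite mulr_ge0 // divr_ge0 ?sqrtr_ge0.
have [z|nz] := eqVneq (q t) 0; first by rewrite z !mulr0 mul0r.
have hF : sqn (dot (e t) om) = F by apply: (mulfI nz); exact: face_fid.
by rewrite cabs_sqn hF /r; field; rewrite gt_eqF ?sqrtF0.
Qed.

Definition face_mix (q : pauli -> R) (a b : bool) : C := \sum_t toC (q t) * (e t a * (e t b)^*).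

(** The left side is Hermitian and kills [om], since both terms send [om] to the same vector;
    [herm_ker] applies. Hence, where [face_psi q] has norm 1, its projector is affine in q. *)
Lemma faceE q a b : face_pt q -> toC v * face_mix q a b - face_psi q a * (face_psi q b)^* =
  toC (v - normsq (face_psi q)) * ((a == b)%:R - om a * (om b)^*).
Proof.
move=> hq; have [q0 q1 _] := hq.
pose M a b := toC v * face_mix q a b - face_psi q a * (face_psi q b)^*.
have tr : M true true + M false false = toC (v - normsq (face_psi q)).
  rewrite rmorphB /= /normsq rmorph_sum big_bool /= !sqnE /M.
  have h : toC v = toC v * face_mix q true true + toC v * face_mix q false false; last first.
    by rewrite [X in _ = X - _]h; ring.
  rewrite -mulrDr -[LHS]mulr1; congr (_ * _); rewrite -big_split -(rmorph1 toC) -q1 rmorph_sum.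
  apply: eq_bigr => t _ /=; rewrite -mulrDr -[LHS]mulr1; congr (_ * _).
  have := congr1 toC (stab1_unit R (t, ep t)); rewrite rmorph1 big_bool rmorphD /= !sqnE => <-.
  by rewrite /e; ring.
rewrite -tr -/(M a b); apply: (herm_ker (om := om)) om1 a b => [a b|a].
  rewrite /M rmorphB !rmorphM /= conjCK [_ * face_psi q a]mulrC; congr (_ * _ - _).
    by rewrite conj_real.
  rewrite /face_mix rmorph_sum; apply: eq_bigr => t _; rewrite !rmorphM /= conjCK [e t a * _]mulrC; congr (_ * _).
  by rewrite conj_real.
have -> : \sum_b M a b * om b = toC v * (\sum_b face_mix q a b * om b) -
    face_psi q a * (dot om (face_psi q))^*.
  rewrite dotC /dot !mulr_sumr -sumrB; apply: eq_bigr => b _; rewrite /M; ring.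
rewrite face_om // conj_real face_psiE mulr_suml.
have -> : \sum_b face_mix q a b * om b = \sum_t toC (q t) * (e t a * dot (e t) om).
  rewrite /face_mix; under eq_bigr do rewrite mulr_suml.
  rewrite exchange_big; apply: eq_bigr => t _; rewrite /dot !mulr_sumr.
  by apply: eq_bigr => b _ /=; ring.
rewrite mulr_sumr -sumrB big1 // => t _.
have -> : toC v = toC r * toC (Num.sqrt v * Num.sqrt F).
  by rewrite -rmorphM /r -{1}sqrtv; congr (real_complex R _); field; rewrite gt_eqF ?sqrtF0.
by rewrite [toC (r * _)]rmorphM /=; ring.
Qed.

Lemma face_conv s q q' : 0 <= s <= 1 -> face_pt q -> face_pt q' ->
  face_pt (fun t => (1 - s) * q t + s * q' t).
Proof.
move=> /andP[s0 s1] [q0 q1 qF] [q0' q1' qF']; split.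
- by move=> t; rewrite addr_ge0 // mulr_ge0 // subr_ge0.
- by rewrite big_split -!mulr_sumr q1 q1' /=; ring.
- by move=> t; rewrite mulrDl -!mulrA qF qF' !mulr0 addr0.
Qed.

Definition delta k : pauli -> R := fun t => (t == k)%:R.

Lemma face_delta q k : face_pt q -> q k != 0 -> face_pt (delta k).
Proof.
move=> hq nz; split=> [t||t].
- by rewrite ler0n.
- by rewrite (bigD1 k) //= big1 ?addr0 /delta ?eqxx // => t /negbTE->.
- rewrite /delta; have [->|_] := eqVneq t k; last by rewrite mul0r.
  by apply: (mulfI nz); rewrite mul1r mulr0; case: hq.
Qed.

Lemma normsq_delta k : face_pt (delta k) -> normsq (face_psi (delta k)) = v.
Proof.
move=> hk.
have -> : face_psi (delta k) = fun y => (toC r * dot (e k) om) * e k y.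
  apply/funext => y; rewrite face_psiE (bigD1 k) //= big1 => [|t].
    by rewrite /delta eqxx mulr1 addr0 mulrA.
  by rewrite /delta => /negbTE->; rewrite mulr0 mul0r.
rewrite normsqZ sqnM sqn_real; have := face_fid k hk; rewrite /delta eqxx !mul1r => ->.
rewrite (_ : normsq _ = 1) ?mulr1; last exact: stab1_unit.
by rewrite /r exprMn exprVn sqrtv sqrtF; field; rewrite gt_eqF.
Qed.

Lemma face_psi_conv s q q' y : face_psi (fun t => (1 - s) * q t + s * q' t) y =
  toC (1 - s) * face_psi q y + toC s * face_psi q' y.
Proof.
rewrite !face_psiE !mulr_sumr -big_split; apply: eq_bigr => t _ /=.
by rewrite !(rmorphM, rmorphD, rmorphB, rmorph1) /=; ring.
Qed.

Lemma normsq_line q q' : exists h, forall s,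
  normsq (face_psi (fun t => (1 - s) * q t + s * q' t)) =
  (1 - s) ^+ 2 * normsq (face_psi q) + s ^+ 2 * normsq (face_psi q') + 2 * s * (1 - s) * h.
Proof.
pose h y := complex.Re (face_psi q y) * complex.Re (face_psi q' y) +
  complex.Im (face_psi q y) * complex.Im (face_psi q' y).
exists (\sum_y h y) => s; rewrite /normsq !mulr_sumr -!big_split; apply: eq_bigr => y _ /=.
rewrite face_psi_conv /h; case: (face_psi q y) (face_psi q' y) => a b [c d].
by rewrite /sqn /=; ring.
Qed.

Definition pure_pt q := face_pt q /\ normsq (face_psi q) = 1.

(** On the line from the face opposite vertex k through q to k, the squared norm is at most 1 at q
    and v > 1 at k, so it is 1 at some [ta] beyond q. Behind q it is 1 at some [tb], unless the foot
    q' already has norm at most 1. *)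
Lemma face_split k q : face_pt q -> normsq (face_psi q) <= 1 -> q k != 0 ->
  exists s qa qb, [/\ 0 <= s <= 1, q = fun t => (1 - s) * qa t + s * qb t, pure_pt qa,
    face_pt qb /\ (normsq (face_psi qb) = 1 \/ (normsq (face_psi qb) <= 1 /\ qb k = 0)) &
    forall t, q t = 0 -> qb t = 0].
Proof.
move=> hq Gq nz; have hk := face_delta hq nz; have Gk := normsq_delta hk.
have [q0 q1 qF] := hq.
pose t0 := q k; have t0p : 0 < t0 by rewrite lt_def nz q0.
have t01 : t0 <= 1 by rewrite -q1 (bigD1 k) //= lerDl sumr_ge0.
have [t1|tn] := eqVneq t0 1.
  have qd : q = delta k.
    apply/funext => t; rewrite /delta; have [->//|tk] := eqVneq t k.
    apply/eqP; rewrite mulr0n eq_le q0 andbT.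
    by move: q1; rewrite (bigD1 k) //= -/t0 t1 => /(canRL (addKr _)); rewrite addNr (bigD1 t) //= => <-;
      rewrite lerDl sumr_ge0.
  by move: Gq; rewrite qd Gk leNgt v1.
have u0 : 0 < 1 - t0 by rewrite subr_gt0 lt_def eq_sym tn.
pose q' t := (q t - t0 * delta k t) / (1 - t0).
have un : 1 - t0 != 0 by rewrite gt_eqF.
have hq' : face_pt q'.
  split=> [t||t]; rewrite /q'.
  - rewrite divr_ge0 ?(ltW u0) // /delta; have [->|_] := eqVneq t k; first by rewrite mulr1 subrr.
    by rewrite mulr0 subr0.
  - rewrite -mulr_suml sumrB -mulr_sumr q1; have [_ -> _] := hk.
    by rewrite mulr1 divff.
  - have [_ _ /(_ t) kF] := hk; move: (qF t) kF; set x := _ - F => e1 e2.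
    by rewrite mulrAC mulrBl -mulrA e1 e2; ring.
pose L s t := (1 - s) * q' t + s * delta k t.
have LE : L t0 = q by apply/funext => t; rewrite /L /q'; field.
have L0 : L 0 = q' by apply/funext => t; rewrite /L; ring.
have L1 : L 1 = delta k by apply/funext => t; rewrite /L; ring.
have hL s : 0 <= s <= 1 -> face_pt (L s) by move=> hs; apply: face_conv.
have supp s t : q t = 0 -> L s t = 0.
  move=> qt; have tk : t != k by apply: contra_neq nz => <-.
  by rewrite /L /q' /delta (negbTE tk) qt !mulr0 subrr mul0r mulr0 addr0.
have [h GL] : exists h, forall s, normsq (face_psi (L s)) =
    (1 - s) ^+ 2 * normsq (face_psi q') + s ^+ 2 * normsq (face_psi (delta k)) + 2 * s * (1 - s) * h.
  exact: normsq_line.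
have [ta /andP[ta0 ta1] Ga] : exists2 s, t0 <= s <= 1 & normsq (face_psi (L s)) = 1.
  have [|s hs hE] := @quad_ivt (normsq (face_psi q')) (normsq (face_psi (delta k))) h t0 1 t01.
    by left; rewrite -!GL LE L1 Gk; split=> //; exact: ltW.
  by exists s => //; rewrite -hE GL.
have [tb /andP[tb0 tb1] Gb] : exists2 s, 0 <= s <= t0 &
    (normsq (face_psi (L s)) = 1 \/ (normsq (face_psi (L s)) <= 1 /\ L s k = 0)).
  have [Gq'|Gq'] := lerP (normsq (face_psi q')) 1.
    exists 0; first by rewrite lexx ltW.
    right; rewrite L0; split=> //.
    by rewrite /q' /delta eqxx mulr1 subrr mul0r.
  have [|s hs hE] := @quad_ivt (normsq (face_psi q')) (normsq (face_psi (delta k))) h 0 t0 (ltW t0p).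
    by right; rewrite -!GL LE L0; split=> //; exact: ltW.
  by exists s => //; left; rewrite -hE GL.
have pa : pure_pt (L ta) by split=> //; apply: hL; rewrite ta1 andbT; lra.
have pb : face_pt (L tb) by apply: hL; rewrite tb0 /=; lra.
(* Equality puts both at t0, so q itself is pure; weight 0 avoids dividing by ta - tb. *)
have [tab|tab] := eqVneq ta tb.
  exists 0, (L ta), (L tb); split=> //.
  - by rewrite lexx ler01.
  - have -> : ta = t0 by lra.
    by rewrite LE; apply/funext => t; ring.
  - by move=> t; exact: supp.
exists ((ta - t0) / (ta - tb)), (L ta), (L tb).
have d0 : 0 < ta - tb by rewrite subr_gt0 lt_def tab; lra.
split=> //; last by move=> t; exact: supp.
  by rewrite divr_ge0 ?ler_pdivrMr //=; lra.
apply/funext => t; rewrite -[in LHS]LE /L; field.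
by rewrite gt_eqF.
Qed.

Definition mix1 q := exists s qa qb, [/\ 0 <= s <= 1, q = fun t => (1 - s) * qa t + s * qb t,
  pure_pt qa & pure_pt qb].

Lemma pure_mix1 q : pure_pt q -> mix1 q.
Proof.
move=> hq; exists 0, q, q; split=> //; first by rewrite lexx ler01.
by apply/funext => t; ring.
Qed.

Lemma face_vertex q k : face_pt q -> (forall t, t != k -> q t = 0) -> 1 < normsq (face_psi q).
Proof.
move=> hq h; have [_ q1 _] := hq.
have qk : q k = 1 by move: q1; rewrite (bigD1 k) //= big1 ?addr0.
have qd : q = delta k.
  by apply/funext => t; rewrite /delta; have [->//|/h] := eqVneq t k.
by rewrite qd normsq_delta // -qd.
Qed.

Lemma face_edge q : face_pt q -> normsq (face_psi q) <= 1 -> q None = 0 -> mix1 q.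
Proof.
move=> hq Gq qN; have [z|nz] := eqVneq (q (Some false)) 0.
  suff : 1 < normsq (face_psi q) by rewrite ltNge Gq.
  by apply: (face_vertex (k := Some true)) hq _ => -[[]|].
have [s [qa [qb [s01 qE pa [hb [Gb|[Gb bz]]] supp]]]] := face_split hq Gq nz.
  by exists s, qa, qb; split.
suff : 1 < normsq (face_psi qb) by rewrite ltNge Gb.
by apply: (face_vertex (k := Some true)) hb _ => -[[]|] // _; exact: supp.
Qed.

(** Splitting off the vertex [None] leaves a pure point together with either a pure point or a point
    of the opposite edge. *)
Lemma face_triangle q : face_pt q -> normsq (face_psi q) <= 1 ->
  exists s qa qb, [/\ 0 <= s <= 1, q = fun t => (1 - s) * qa t + s * qb t, mix1 qa & mix1 qb].
Proof.
move=> hq Gq; have [z|nz] := eqVneq (q None) 0.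
  exists 0, q, q; split; rewrite ?lexx ?ler01 //; [by apply/funext => t; ring | | ]; exact: face_edge.
have [s [qa [qb [s01 -> pa [hb [Gb|[Gb bz]]] supp]]]] := face_split hq Gq nz.
  by exists s, qa, qb; split=> //; exact: pure_mix1.
by exists s, qa, qb; split=> //; [exact: pure_mix1 | exact: face_edge].
Qed.

(** The operator |om><om| / F; the second vector is zero because [cert1] asks for two. *)
Definition face_wit (b : bool) : vec1 := fun y => if b then toC (Num.sqrt F)^-1 * om y else 0.

Lemma wit_face u : wit face_wit u = sqn (dot om u) / F.
Proof.
rewrite /wit big_bool /= [X in _ + X](_ : _ = 0) ?addr0; last first.
  by rewrite /dot big1 ?sqn0 // => y _; rewrite /face_wit rmorph0 mul0r.
have -> : dot (face_wit true) u = toC (Num.sqrt F)^-1 * dot om u.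
  rewrite /dot mulr_sumr; apply: eq_bigr => y _; rewrite rmorphM /= conj_real; ring.
by rewrite sqnM sqn_real exprVn sqrtF mulrC.
Qed.

Lemma face_cert (S : bool -> bool -> C) q : face_pt q ->
  (forall u : vec1, 0 <= \sum_a \sum_b (u a)^* * S a b * u b) ->
  (forall a b, S a b = toC v * face_mix q a b - toC (v - 1) * ((a == b)%:R - om a * (om b)^*)) ->
  exists t p c g, cert1 S t p c g.
Proof.
move=> hq psdS SE.
have Gq : normsq (face_psi q) <= 1.
  set G := normsq _.
  have SE' a b : S a b = face_psi q a * (face_psi q b)^* + toC (1 - G) * ((a == b)%:R - om a * (om b)^*).
    have := faceE a b hq; rewrite -/G SE => /eqP; rewrite subr_eq => /eqP ->.
    by rewrite !rmorphB /=; ring.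
  (* This u is orthogonal to [face_psi q], so the quadratic form of [S] at u is (1 - G)
     |<om|psi>|^2, and the overlap is nonzero. *)
  pose u (b : bool) : C := if b then (face_psi q false)^* else - (face_psi q true)^*.
  have := psdS u; rewrite (_ : \sum_a _ = toC ((1 - G) * sqn (dot om (face_psi q)))).
    rewrite ler0c pmulr_lge0 ?subr_ge0 // face_om // sqn_real exprn_gt0 //.
    by rewrite mulr_gt0 ?sqrtv0 ?sqrtF0.
  have om1C := congr1 toC om1; rewrite /normsq rmorph_sum big_bool rmorph1 /= !sqnE in om1C.
  rewrite [RHS]rmorphM /= sqnE dotC /dot !big_bool !SE' /u /=.
  rewrite !rmorphN /= !conjCK; move: om1C.
  set a := om true; set b := om false; set c := face_psi q true; set d := face_psi q false => om1C.
  set g := toC _.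
  transitivity (g * ((a^* * a + b^* * b) * (c^* * c + d^* * d) - (b^* * c^* - a^* * d^*) * (b * c - a * d))).
    by rewrite om1C; ring.
  by ring.
have [s [qa [qb [s01 qE [s1 [q11 [q12 [s11 E1 p11 p12]]]] [s2 [q21 [q22 [s21 E2 p21 p22]]]]]]]] :=
  face_triangle hq Gq.
pose Q (a : bool * bool) := if a.1 then (if a.2 then q22 else q21) else (if a.2 then q12 else q11).
pose w (x : R) (b : bool) := if b then x else 1 - x.
pose p (a : bool * bool) : R := w s a.1 * (if a.1 then w s2 a.2 else w s1 a.2).
have hQ a : pure_pt (Q a) by case: a => [[] []].
have bigp (V : nmodType) (f : bool * bool -> V) : \sum_a f a =
    f (true, true) + f (true, false) + (f (false, true) + f (false, false)).
  transitivity (\sum_a \sum_b f (a, b)); last by rewrite !big_bool.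
  by rewrite pair_bigA; apply: eq_bigr => -[].
have psiE : psi1 (fun a => face_coef (Q a)) = fun a => face_psi (Q a) by [].
have p1 : \sum_a p a = 1 by rewrite bigp /p /w /=; ring.
exists (Num.sqrt v), p, (fun a => face_coef (Q a)), face_wit; split.
- exact: sqrtv0.
- split=> // a; move: s01 s11 s21 => /andP[? ?] /andP[? ?] /andP[? ?].
  by rewrite mulr_ge0 // /w; case: a => [[] []] //=; rewrite subr_ge0.
- split=> [a|a b]; first by rewrite psiE; case: (hQ a).
  rewrite SE psiE.
  have E c : face_psi (Q c) a * (face_psi (Q c) b)^* =
      toC v * face_mix (Q c) a b - toC (v - 1) * ((a == b)%:R - om a * (om b)^*).
    have [h1 h2] := hQ c; have := faceE a b h1; rewrite h2 => <-; ring.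
  under eq_bigr do rewrite E mulrBr; rewrite sumrB -mulr_suml -rmorph_sum p1 rmorph1 mul1r.
  congr (_ - _); under eq_bigr do rewrite mulrCA; rewrite -mulr_sumr; congr (_ * _).
  rewrite /face_mix; under [RHS]eq_bigr do rewrite mulr_sumr; rewrite [RHS]exchange_big.
  apply: eq_bigr => t _ /=; rewrite bigp /p /w /Q /= qE E1 E2.
  by rewrite !(rmorphM, rmorphD, rmorphB, rmorph1) /=; ring.
- by move=> a; apply: face_coef_norm; case: (hQ a).
- split=> [t|a]; first by rewrite wit_face ler_pdivrMr // mul1r.
  rewrite wit_face psiE face_om; last by case: (hQ a).
  by rewrite sqn_real exprMn sqrtv sqrtF mulfK // gt_eqF.
Qed.
End Face.

(** * Tensor products *)

Section Final.
Variable R : realType.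
Local Notation C := R[i].
Local Notation toC := (real_complex R).
Local Notation vec1 := (bool -> C).

Lemma bloch_vector (u1 u2 u3 : R) : u1 ^+ 2 + u2 ^+ 2 + u3 ^+ 2 = 1 ->
  exists om : vec1, [/\ normsq om = 1, bl (Some false) om = u1 / 2,
    bl (Some true) om = u2 / 2 & bl None om = u3 / 2].
Proof.
(* The general lift divides by the amplitude sqrt ((1 + u3) / 2); the south pole is lifted to |1>
   instead. *)
move=> hu; have [z|nz] := eqVneq u3 (-1).
  have [z1 z2] : u1 = 0 /\ u2 = 0.
    have h1 := sqr_ge0 u1; have h2 := sqr_ge0 u2; move: hu; rewrite z => hu.
    by split; apply/eqP; rewrite -sqrf_eq0; apply/eqP; lra.
  exists (fun b => b%:R); rewrite z z1 z2 /normsq big_bool /bl /sqn /=.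
  by split; field.
have u3p : 0 < 1 + u3.
  rewrite lt_def; apply/andP; split; first by apply: contra_neq nz => h; lra.
  have h1 := sqr_ge0 u1; have h2 := sqr_ge0 u2.
  suff : `|u3| <= 1 by rewrite ler_norml; lra.
  by rewrite -(@ler_pXn2r _ 2) ?nnegrE // real_normK ?num_real // expr1n; lra.
have : Num.sqrt ((1 + u3) / 2) ^+ 2 = (1 + u3) / 2 by rewrite sqr_sqrtr // divr_ge0 // ltW.
set a := Num.sqrt _ => a2.
have an : a != 0.
  by apply/eqP => h; move: a2; rewrite h expr0n /=; lra.
have u12 : u1 ^+ 2 + u2 ^+ 2 = 4 * a ^+ 2 * (1 - a ^+ 2) by rewrite a2; lra.
have w2 : (u1 / (2 * a)) ^+ 2 + (u2 / (2 * a)) ^+ 2 = 1 - a ^+ 2.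
  rewrite (_ : _ + _ = (u1 ^+ 2 + u2 ^+ 2) / (4 * a ^+ 2)); last by field.
  by rewrite u12; field.
exists (fun b => if b then Complex (u1 / (2 * a)) (u2 / (2 * a)) else Complex a 0).
rewrite /normsq big_bool /bl /sqn /=; split.
- by lra.
- by field.
- by field.
- by lra.
Qed.

Lemma big_pauli (V : nmodType) (f : option bool -> V) :
  \sum_t f t = f (Some false) + f (Some true) + f None.
Proof.
rewrite (bigD1 (Some false)) //= (bigD1 (Some true)) //= (bigD1 None) //= big1 ?addr0 ?addrA //.
by move=> [[]|].
Qed.

(** Since 1 - |om><om| has Bloch vector -u, the vector (1 + m) w + m u is that of v mix - (v - 1) (1
    - |om><om|) with v = 1 + m, where mix has weights |w_i|. The condition w_i u_i = |w_i| tau gives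
    maximal fidelity on the support. *)
Lemma cert1_face (x y z : R) :
  (forall u : vec1, 0 <= \sum_a \sum_b (u a)^* * bmat (1 / 2) (x / 2) (y / 2) (z / 2) a b * u b) ->
  bloch_cert x y z ->
  exists t p c g, cert1 (bmat (1 / 2) (x / 2) (y / 2) (z / 2)) t p c g.
Proof.
move=> psdS [m [w1 [w2 [w3 [u1 [u2 [u3 [tau
  [m0 [xE yE zE] [w_sum u_norm] [t1 t2 t3] [g1 g2 g3]]]]]]]]]].
have [om [om1 b1 b2 b3]] := bloch_vector u_norm.
pose w (t : option bool) := match t with None => w3 | Some false => w1 | Some true => w2 end.
pose u (t : option bool) := match t with None => u3 | Some false => u1 | Some true => u2 end.
have blE t : bl t om = u t / 2 by case: t => [[]|].
have bl0E : bl0 om = 1 / 2 by rewrite /bl0 -om1 /normsq big_bool addrC.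
pose F := (1 + tau) / 2.
have tau0 : 0 <= tau by exact: le_trans t1.
have F0 : 0 < F by rewrite /F; lra.
have v1 : 1 < 1 + m by lra.
have fid s : sqn (dot om (stab1 R s)) = 1 / 2 + (-1) ^+ s.2 * (u s.1 / 2).
  by rewrite dot_stab1 bl0E blE.
have om_stab s : sqn (dot om (stab1 R s)) <= F.
  rewrite fid /F; have : `|u s.1| <= tau by case: s.1 => [[]|].
  by rewrite ler_norml => /andP[h1 h2]; case: s.2; rewrite ?expr0 ?expr1; lra.
apply: (face_cert om1 F0 v1 om_stab (ep := fun t => w t < 0) (q := fun t => `|w t|)) => // [|a b].
  split=> [t||t] //; first by rewrite big_pauli.
  rewrite -sqnJ dotC fid /= /F.
  have h : w t * u t = `|w t| * tau by case: t => [[]|].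
  have := sign_abs (w t); set sg := (-1) ^+ _ => hs.
  transitivity ((sg * `|w t| * u t - `|w t| * tau) / 2); first by field.
  by rewrite hs h subrr mul0r.
rewrite /face_mix big_pauli !bmatE !bl0_stab1 !bl_stab1 /= bl0E b1 b2 b3.
have := sign_abs w1; have := sign_abs w2; have := sign_abs w3.
set s1 := (-1) ^+ (w1 < 0)%R; set s2 := (-1) ^+ (w2 < 0)%R; set s3 := (-1) ^+ (w3 < 0)%R.
set n1 := `|w1|; set n2 := `|w2|; set n3 := `|w3| => hs3 hs2 hs1.
have ws : n1 + n2 + n3 = 1 by [].
case: a b => [] []; apply/eqP; rewrite eq_complex /=; apply/andP; split; apply/eqP;
  rewrite ?xE ?yE ?zE -?hs1 -?hs2 -?hs3.
all: try by field.
all: have -> : n1 = 1 - n2 - n3 by lra.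
all: by field.
Qed.

Lemma big_qbasis1 (V : nmodType) (f : qbasis 1 -> V) : \sum_x f x = \sum_b f [ffun=> b].
Proof.
rewrite (reindex (fun b : bool => [ffun=> b] : qbasis 1)) //.
exists (fun x : qbasis 1 => x ord0) => [b _|x _]; first by rewrite ffunE.
by apply/ffunP => i; rewrite ffunE (ord1 i).
Qed.

Lemma cert1_exists (rho : op R 1) : dstate rho ->
  exists t p c g, cert1 (fun a b => rho [ffun=> a] [ffun=> b]) t p c g.
Proof.
move=> [psd_rho tr_rho]; pose S (a b : bool) : C := rho [ffun=> a] [ffun=> b]; rewrite -/S.
have psdS (u : vec1) : 0 <= \sum_a \sum_b (u a)^* * S a b * u b.
  have := psd_rho (fun x => u (x ord0)); rewrite big_qbasis1.
  by under eq_bigr do rewrite big_qbasis1; under eq_bigr do under eq_bigr do rewrite !ffunE.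
have trS : \sum_a S a a = 1 by rewrite -tr_rho big_qbasis1.
have [x [y [z [SE hb]]]] := bloch_of_state psdS trS.
have SF : S = bmat (1 / 2) (x / 2) (y / 2) (z / 2).
  by apply/funext => a; apply/funext => b; exact: SE.
rewrite SF in psdS *; have [L|L] := lerP (`|x| + `|y| + `|z|) 1.
  exact: cert1_octahedron.
have [x1 y1 z1] := bloch_le1 hb.
by apply: cert1_face => //; exact: bloch_certP.
Qed.

(** * Products of one-qubit certificates *)

Section Tensor.
Variables (m : nat) (sigma : 'I_m -> op R 1).
Variables (t : 'I_m -> R) (p : 'I_m -> bool * bool -> R).
Variables (c : 'I_m -> bool * bool -> option bool * bool -> C) (g : 'I_m -> bool -> vec1).
Hypothesis certs : forall j,
  cert1 (fun a b => sigma j [ffun=> a] [ffun=> b]) (t j) (p j) (c j) (g j).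

Let pT (f : {ffun 'I_m -> bool * bool}) : R := \prod_j p j (f j).
Let cT (f : {ffun 'I_m -> bool * bool}) (h : {ffun 'I_m -> option bool * bool}) : C :=
  \prod_j c j (f j) (h j).
Let phiT (h : {ffun 'I_m -> option bool * bool}) : vec R m := pstab R h.
Let tT := \prod_j t j.

Lemma tensor_psi f x : \sum_h cT f h * phiT h x = \prod_j psi1 (c j) (f j) (x j).
Proof. by rewrite /psi1 bigA_distr_bigA; apply: eq_bigr => h _; rewrite -big_split. Qed.

Lemma tensor_p_ge0 f : 0 <= pT f.
Proof. by apply: prodr_ge0 => j _; case: (certs j) => _ []. Qed.

Lemma tensor_p_sum : \sum_f pT f = 1.
Proof. by rewrite -bigA_distr_bigA big1 // => j _; case: (certs j) => _ []. Qed.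

Lemma tensor_rho x y : tensor sigma x y = \sum_f toC (pT f) *
  dyad (fun x => \sum_h cT f h * phiT h x) (fun x => \sum_h cT f h * phiT h x) x y.
Proof.
rewrite /tensor (eq_bigr (fun j => \sum_a toC (p j a) *
    (psi1 (c j) a (x j) * (psi1 (c j) a (y j))^*))) => [|j _]; last first.
  by case: (certs j) => _ _ [_ ->].
rewrite bigA_distr_bigA; apply: eq_bigr => f _; rewrite /dyad !tensor_psi !rmorph_prod.
by rewrite -!big_split.
Qed.

Lemma tensor_psi_unit f : unit_vec (fun x => \sum_h cT f h * phiT h x).
Proof.
rewrite /unit_vec; under eq_bigr do rewrite tensor_psi sqn_norm
  (big_morph (@sqn R) (@sqnM R) (sqn1 R)) rmorph_prod.
rewrite (dot_bigA (fun j b => toC (sqn (psi1 (c j) (f j) b)))) big1 // => j _.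
have [_ _ [/(_ (f j)) h _] _ _] := certs j.
by rewrite -rmorph_sum -[\sum_i _]/(normsq _) h rmorph1.
Qed.

Lemma tensor_t_gt0 : 0 < tT.
Proof. by apply: prodr_gt0 => j _; case: (certs j). Qed.

Lemma tensor_cabs f : \sum_h cabs (cT f h) = tT.
Proof.
have cabs_prod (h : {ffun 'I_m -> option bool * bool}) :
    cabs (cT f h) = \prod_j cabs (c j (f j) (h j)).
  by rewrite (big_morph (@cabs R) (@cabsM R) (id1 := 1)) // cabs_sqn sqn1 sqrtr1.
under eq_bigr do rewrite cabs_prod.
by rewrite -(bigA_distr_bigA (fun j s => cabs (c j (f j) s))); apply: eq_bigr => j _; case: (certs j).
Qed.

Lemma wit_prod (v : 'I_m -> vec1) :
  wit (gten g) (fun x => \prod_j v j (x j)) = \prod_j wit (g j) (v j).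
Proof.
rewrite /wit bigA_distr_bigA; apply: eq_bigr => B _.
rewrite -(big_morph (@sqn R) (@sqnM R) (sqn1 R)); congr sqn.
rewrite /dot bigA_distr_bigA; apply: eq_bigr => x _.
by rewrite /gten rmorph_prod -big_split.
Qed.

Lemma tensor_wit_psi f : wit (gten g) (fun x => \sum_h cT f h * phiT h x) = tT ^+ 2.
Proof.
rewrite (_ : (fun x : qbasis m => \sum_h cT f h * phiT h x) =
  (fun x : qbasis m => \prod_j psi1 (c j) (f j) (x j))); last by apply/funext => x; exact: tensor_psi.
by rewrite (wit_prod (fun j => psi1 (c j) (f j))) -prodrXl; apply: eq_bigr => j _; case: (certs j) => _ _ _ _ [].
Qed.

Lemma tensor_wit_stab phi : stab_state phi -> wit (gten g) phi <= 1.
Proof. by apply: stab_wit_le1 => j s; case: (certs j) => _ _ _ _ []. Qed.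

Lemma tensor_monotones : [/\ dyadic_neg (tensor sigma) = tT ^+ 2,
  mixed_extent (tensor sigma) = tT ^+ 2, gen_rob (tensor sigma) = tT ^+ 2
  & equimagical (tensor sigma)].
Proof.
have W := tensor_wit_stab; have p0 := tensor_p_ge0; have p1 := tensor_p_sum.
have hphi h : stab_state (phiT h) by exact: pstab_stab.
have psi1 := tensor_psi_unit; have hrho := tensor_rho; have t0 := tensor_t_gt0.
have hc := tensor_cabs; have hw := tensor_wit_psi; split.
- exact: (cert_dyadic W p0 p1 hphi hrho hc hw).
- exact: (cert_mixed_extent W p0 p1 hphi psi1 hrho hc hw).
- exact: (cert_gen_rob W p0 p1 hphi hrho t0 hc hw).
- exact: (cert_equimagical W p0 p1 hphi psi1 hrho hc hw).
Qed.
End Tensor.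

Lemma tensor_one (rho : op R 1) : tensor (fun _ : 'I_1 => rho) = rho.
Proof.
apply/funext => x; apply/funext => y; rewrite /tensor big_ord1.
by congr rho; apply/ffunP => i; rewrite ffunE (ord1 i).
Qed.
End Final.

Theorem theorem5 (R : realType) (m : nat) (sigma : 'I_m -> op R 1) :
  (forall j, dstate (sigma j)) ->
  dyadic_neg (tensor sigma) = mixed_extent (tensor sigma) /\
  mixed_extent (tensor sigma) = gen_rob (tensor sigma) /\
  gen_rob (tensor sigma) = \prod_(j < m) gen_rob (sigma j) /\
  equimagical (tensor sigma).
Proof.
move=> hsigma.
have /choice[t] : forall j, exists t, exists p c g,
    cert1 (fun a b => sigma j [ffun=> a] [ffun=> b]) t p c g.
  by move=> j; exact: cert1_exists.
move=> /choice[p] /choice[c] /choice[g] certs.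
have [-> -> -> eqm] := tensor_monotones certs; do !split=> //.
rewrite -prodrXl; apply: eq_bigr => j _.
(* A single qubit is a product with one factor, so [gen_rob (sigma j)] is the square of [t j]. *)
have [_ _ h _] := tensor_monotones (sigma := fun _ : 'I_1 => sigma j) (fun _ => certs j).
by rewrite tensor_one big_ord1 in h.
Qed.
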